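(* There is an algorithm which, given a cocomparability graph $G=(V,E)$ with $n$ vertices together with an umbrella-free ordering $\pi$ of $V$, computes a longest path of $G$ in $O(n^{4})$ time.
   Context: All graphs are finite, simple and undirected. A path is a sequence of distinct vertices $v_1,\dots,v_k$ with $v_iv_{i+1}\in E$ for all $i$; its length is its number of vertices, and a longest path is a path with the maximum number of vertices. A cocomparability graph is a graph whose complement admits a transitive orientation. An ordering of $V$ is umbrella-free if for all vertices $x<y<z$ in the ordering, $xz\in E$ implies $xy\in E$ or $yz\in E$; a graph is a cocomparability graph if and only if it admits an umbrella-free ordering. *)

(* Defs.v *)
From mathcomp Require Import all_boot.

Set Implicit Arguments.
Unset Strict Implicit.
Unset Printing Implicit Defensive.

(** * Graphs, paths, cocomparability *)

Record sgraph (V : finType) := SGraph {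
  adj :> rel V;
  adj_sym : symmetric adj;
  adj_irr : irreflexive adj
}.

Definition complement (V : finType) (e : rel V) : rel V :=
  [rel x y | (x != y) && ~~ e x y].

(* Each edge of [e] gets exactly one of its two directions in [r]. *)
Definition transitive_orientation (V : finType) (e r : rel V) : Prop :=
  [/\ forall x y, e x y = r x y || r y x,
      forall x y, ~~ (r x y && r y x)
    & transitive r].

Definition cocomparability (V : finType) (G : sgraph V) : Prop :=
  exists r : rel V, transitive_orientation (complement G) r.

Definition vertex_ordering (V : finType) (pi : seq V) : Prop :=
  uniq pi /\ forall x : V, x \in pi.

Definition umbrella_free (V : finType) (G : sgraph V) (pi : seq V) : Prop :=
  forall x y z : V,
    index x pi < index y pi -> index y pi < index z pi ->
    G x z -> G x y \/ G y z.

(* The empty sequence is a path; this only matters for the graph without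
   vertices, whose longest path is then the empty one. *)
Definition is_path (V : finType) (G : sgraph V) (p : seq V) : Prop :=
  uniq p /\ sorted G p.

Definition longest_path (V : finType) (G : sgraph V) (p : seq V) : Prop :=
  is_path G p /\ forall q : seq V, is_path G q -> size q <= size p.

(** * Word RAM programs

   The machine has scalar variables and arrays, both named by natural numbers
   that are constants of the program, and random access inside an array.  Every
   cell holds a machine word, i.e. a number smaller than a bound [B].  A run
   that would produce a number >= [B] (in particular an array index >= [B]) is
   stuck, so unit-cost arithmetic cannot be abused through huge numbers. *)

Inductive binop := Add | Sub | Mul | Eq | Lt.

Inductive expr :=
| Num of nat
| Var of nat
| Get of nat & expr                (* [Get a i] reads cell [i] of array [a] *)
| Bin of binop & expr & expr.

Inductive com :=
| Skip
| Assign of nat & expr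
| Put of nat & expr & expr         (* [Put a i e] writes [e] to cell [i] of [a] *)
| Seq of com & com
| If of expr & com & com
| While of expr & com.

Record state := State {
  var : nat -> nat;
  arr : nat -> nat -> nat
}.

Definition set_var (s : state) (x v : nat) : state :=
  State (fun y => if y == x then v else var s y) (arr s).

Definition set_arr (s : state) (a i v : nat) : state :=
  State (var s)
    (fun b j => if (b == a) && (j == i) then v else arr s b j).

(* [Sub] is truncated subtraction; [Eq] and [Lt] return 0 or 1. *)
Definition binop_sem (o : binop) (u v : nat) : nat :=
  match o with
  | Add => u + v
  | Sub => u - v
  | Mul => u * v
  | Eq => u == v
  | Lt => u < v
  end.

Definition word (B v : nat) : option nat := if v < B then Some v else None.

Fixpoint eval (B : nat) (s : state) (e : expr) : option nat :=
  match e with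
  | Num c => word B c
  | Var x => word B (var s x)
  | Get a i => if eval B s i is Some j then word B (arr s a j) else None
  | Bin o e1 e2 =>
      match eval B s e1, eval B s e2 with
      | Some u, Some v => word B (binop_sem o u v)
      | _, _ => None
      end
  end.

Fixpoint cost (e : expr) : nat :=
  match e with
  | Num _ | Var _ => 1
  | Get _ i => (cost i).+1
  | Bin _ e1 e2 => (cost e1 + cost e2).+1
  end.

(* [exec B c s t s']: with word bound [B], started in [s], the program [c]
   halts in state [s'] after exactly [t] steps.  Nonzero guards are true. *)
Inductive exec (B : nat) : com -> state -> nat -> state -> Prop :=
| ExecSkip s :
    exec B Skip s 1 s
| ExecAssign s x e v :
    eval B s e = Some v ->
    exec B (Assign x e) s (cost e).+1 (set_var s x v)
| ExecPut s a i e j v :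
    eval B s i = Some j -> eval B s e = Some v ->
    exec B (Put a i e) s (cost i + cost e).+1 (set_arr s a j v)
| ExecSeq s1 s2 s3 c1 c2 t1 t2 :
    exec B c1 s1 t1 s2 -> exec B c2 s2 t2 s3 ->
    exec B (Seq c1 c2) s1 (t1 + t2) s3
| ExecIf s s' b c1 c2 v t :
    eval B s b = Some v ->
    exec B (if v != 0 then c1 else c2) s t s' ->
    exec B (If b c1 c2) s (cost b + t).+1 s'
| ExecWhileFalse s b c :
    eval B s b = Some 0 ->
    exec B (While b c) s (cost b).+1 s
| ExecWhileTrue s1 s2 s3 b c v t1 t2 :
    eval B s1 b = Some v -> v != 0 ->
    exec B c s1 t1 s2 -> exec B (While b c) s2 t2 s3 ->
    exec B (While b c) s1 (cost b + t1 + t2).+1 s3.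

(* Variable 0 holds n, array 0 the adjacency matrix of [G] in row-major order,
   array 1 the vertices in the order [pi]; everything else is 0. *)
Definition input (n : nat) (G : sgraph 'I_n) (pi : seq 'I_n) : state :=
  State
    (fun x => if x == 0 then n else 0)
    (fun a i =>
       if a == 0 then
         nat_of_bool
           [exists u : 'I_n, exists v : 'I_n, (i == u * n + v) && G u v]
       else if a == 1 then nth 0 (map val pi) i
       else 0).

(* Variable 0 holds the length of the result, stored from cell 0 of array 0. *)
Definition output (s : state) : seq nat := mkseq (arr s 0) (var s 0).

Definition bigO (f g : nat -> nat) : Prop :=
  exists C N : nat, forall n : nat, N <= n -> f n <= C * g n.

(* Main.v *)
Require Import Defs.
From mathcomp Require Import all_boot.
From mathcomp Require Import zify.

(** Call u below v if u comes before v in the ordering and uv is not an edge;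
    umbrella-freeness says that this is a partial order, so paths are sequences
    of vertices in which neighbours are incomparable.

    First replace pi by a lexicographic depth-first search ordering sigma that
    is still a linear extension.  In sigma every maximal path can be rearranged
    into a greedy one, which starts at its sigma-last vertex and always goes on
    to the sigma-last neighbour among its remaining vertices.  A greedy path
    never visits v after a vertex below v.  Let u_i be the sigma-first vertex of
    a greedy path P u_i Q.  If x is the last vertex of P, then greediness puts
    all of Q below x.  Conversely, if no vertex of P is below its last vertex x,
    if x is adjacent to u_i and if Q lies after u_i and below x, then P and Q are
    disjoint and u_i is adjacent to all of Q.

    Hence it suffices to compute, for all i, j, k, a longest path that consists
    of vertices from u_i on that are below u_j and that ends in u_k.  There are
    O(n^3) such triples and O(n) candidates x for each of them. *)

Set Implicit Arguments.
Unset Strict Implicit.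
Unset Printing Implicit Defensive.

(** * Lexicographic depth-first search orderings *)

(** The obstacle is to make a path greedy. The wanted vertex [c] is brought to the front by
    reversing the block that ends in it, but then the old head [b] has to be joined to the vertex
    [a] that followed [c], and the edge may be missing. In that case [a] is below [b], and the
    four-point property of an LDFS ordering, applied to the non-edge [ab] and the edge [ac], yields
    a vertex between [a] and [b] that repairs the path. The repair may bring in a new vertex. Hence
    a path counts as maximal only if no vertex can be added to it even after rearranging it, as is
    the case for every longest path.

    Greediness is not maintained by the recursion. Soundness concerns a weaker class, the paths
    without a vertex below their last one; completeness only says that an entry is at least as long
    as every greedy path with the same parameters. *)

Section Ldfs.

Variables (T : eqType) (e : rel T).

(* Moving the neighbours of x to the front, stably, keeps l sorted by its LDFS
   labels, with ties broken by the initial order; m is fuel. *)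
Fixpoint ldfs (m : nat) (l : seq T) : seq T :=
  if m isn't m'.+1 then [::] else
  if l isn't x :: l' then [::] else
  x :: ldfs m' (filter (e x) l' ++ filter (predC (e x)) l').

Lemma perm_ldfs m l : size l <= m -> perm_eq (ldfs m l) l.
Proof.
elim: m l => [|m IH] [|x l] //= ll.
have /permPl pl := perm_filterC (e x) l.
by rewrite perm_cons; rewrite -(permPr pl); apply: IH; rewrite (perm_size pl).
Qed.

(** Two elements change their relative order only at a pivot adjacent to exactly one of them, where
    the neighbour overtakes the other. The first pivot at which [b] overtakes [c] is the required
    [d]; it is output before both. *)
Lemma ldfs_swap m l b c :
  size l <= m -> uniq l ->
  subseq [:: c; b] l -> subseq [:: b; c] (ldfs m l) ->
  exists2 d, subseq [:: d; b] (ldfs m l) & e d b && ~~ e d c.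
Proof.
elim: m l => [|m IH] [|x l] // ll /= /andP[xl ul].
have /permPl pl := perm_filterC (e x) l.
have um : uniq (ldfs m (filter (e x) l ++ filter (predC (e x)) l)).
  by rewrite (perm_uniq (perm_ldfs _)) ?(perm_uniq pl) ?(perm_size pl).
have mm y : y \in ldfs m (filter (e x) l ++ filter (predC (e x)) l) -> y \in l.
  by rewrite (perm_mem (perm_ldfs _)) ?(perm_mem pl) ?(perm_size pl).
case: (altP (c =P x)) => [->|cx] /=.
  rewrite sub1seq => bl; case: (altP (b =P x)) => [bx|bx h].
    by rewrite bx (negPf xl) in bl.
  by have /mm := mem_subseq h (mem_last b [:: x]); rewrite (negPf xl).
case: (altP (b =P x)) => [->|bx] /= h1 h2.
  by have := mem_subseq h1 (mem_last c [:: x]); rewrite (negPf xl).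
have bl : b \in l by apply: (mem_subseq h1); rewrite !inE eqxx orbT.
have cl : c \in l by apply: (mem_subseq h1); rewrite !inE eqxx.
have IH' : subseq [:: c; b] (filter (e x) l ++ filter (predC (e x)) l) ->
    exists2 d, subseq [:: d; b] (x :: ldfs m (filter (e x) l ++ filter (predC (e x)) l))
      & e d b && ~~ e d c.
  move=> h; have [||//|d hd ed] := IH (filter (e x) l ++ filter (predC (e x)) l) _ _ h.
  - by rewrite (perm_size pl).
  - by rewrite (perm_uniq pl).
  by exists d => //; apply: subseq_trans hd (subseq_cons _ _).
case eb: (e x b); case ec: (e x c).
- by apply: IH'; apply: subseq_trans (prefix_subseq _ _); rewrite subseq_filter /= eb ec.
- exists x; last by rewrite eb ec.
  rewrite /= eqxx sub1seq (perm_mem (perm_ldfs _)) ?(perm_mem pl) ?(perm_size pl) //.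
- apply: IH'; rewrite -[[:: c; b]]/([:: c] ++ [:: b]); apply: cat_subseq;
    by rewrite sub1seq mem_filter /= ?eb ?ec ?bl ?cl.
- by apply: IH'; apply: subseq_trans (suffix_subseq _ _); rewrite subseq_filter /= eb ec.
Qed.

(** Once [a] has been the pivot, its neighbour [c] stands before its non-neighbour [b]. As [b] is
    nevertheless output first, [ldfs_swap] applies to what remains after [a]. *)
Lemma ldfs_four_points m l a b c :
  size l <= m -> uniq l -> subseq [:: a; b; c] (ldfs m l) ->
  ~~ e a b -> e a c ->
  exists2 d, subseq [:: a; d; b] (ldfs m l) & e d b && ~~ e d c.
Proof.
elim: m l => [|m IH] [|x l] // ll /= /andP[xl ul].
have /permPl pl := perm_filterC (e x) l.
set l' := filter _ _ ++ _ in pl *.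
have sl' : size l' <= m by rewrite (perm_size pl).
have ul' : uniq l' by rewrite (perm_uniq pl).
case: (altP (a =P x)) => [->|ax] h eab eac.
  have bl : b \in l'.
    by rewrite -(perm_mem (perm_ldfs sl')); apply: (mem_subseq h); rewrite !inE eqxx.
  have cl : c \in l'.
    by rewrite -(perm_mem (perm_ldfs sl')); apply: (mem_subseq h); rewrite !inE eqxx orbT.
  have [|d hd ed] := @ldfs_swap m l' b c sl' ul' _ h; last by exists d.
  rewrite -[[:: c; b]]/([:: c] ++ [:: b]); apply: cat_subseq;
  by rewrite sub1seq mem_filter /= ?eab ?eac -(perm_mem pl).
have [d hd ed] := IH _ sl' ul' h eab eac.
by exists d => //; apply: subseq_trans hd (subseq_cons _ _).
Qed.

(** Moving a neighbour [u] of the pivot [x] ahead of a non-neighbour [v] does harm only if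
    [prec v u]. But [v] comes after [x] and is not adjacent to it, so [prec x v], and [prec x u]
    would contradict the edge. *)
Lemma ldfs_linext (prec : rel T) m l :
  transitive prec -> symmetric e ->
  (forall x y, prec x y -> ~~ e x y) ->
  (forall x y, x != y -> ~~ e x y -> prec x y || prec y x) ->
  size l <= m -> uniq l ->
  pairwise (fun x y => ~~ prec y x) l -> pairwise (fun x y => ~~ prec y x) (ldfs m l).
Proof.
move=> tr es lte lttot; elim: m l => [|m IH] [|x l] // ll /= /andP[xl ul] /andP[px pl].
have /permPl fl := perm_filterC (e x) l.
set l' := filter _ _ ++ _ in fl *.
have sl' : size l' <= m by rewrite (perm_size fl).
have ul' : uniq l' by rewrite (perm_uniq fl).
apply/andP; split.
  by rewrite (perm_all _ (perm_ldfs sl')) (perm_all _ fl).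
apply: IH => //; rewrite /l' pairwise_cat !pairwise_filter // !andbT.
apply/allrelP => u v; rewrite !mem_filter /= => /andP[xu _] /andP[xv vl].
apply/negP => vu; have xv' : prec x v.
  have xNv : x != v by apply: contraNneq xl => ->.
  by have := lttot _ _ xNv xv; rewrite (negPf (allP px _ vl)) orbF.
by have := lte _ _ (tr _ _ _ xv' vu); rewrite xu.
Qed.

End Ldfs.

(** * Greedy paths *)

Section Greedy.

Variable E : rel nat.
Hypothesis Esym : symmetric E.

(** Numbers stand for positions in sigma. As sigma is a linear extension, the partial order on
    vertices becomes [<] restricted to non-edges. *)
Definition prec (x y : nat) := (x < y) && ~~ E x y.

Hypothesis precT : transitive prec.
Hypothesis four_points : forall a b c, a < b -> b < c -> ~~ E a b -> E a c ->
  exists2 d, a < d < b & E d b && ~~ E d c.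

Lemma prec_nadj x y : prec x y -> ~~ E x y.
Proof. by case/andP. Qed.

Lemma prec_nadj_sym x y : prec x y -> ~~ E y x.
Proof. by rewrite Esym => /andP[]. Qed.

Lemma prec_irr x : prec x x = false.
Proof. by rewrite /prec ltnn. Qed.

Lemma incomparable x y : x != y -> ~~ prec x y -> ~~ prec y x -> E x y.
Proof.
rewrite /prec (Esym y x); case: (ltngtP x y) => //= _ _; last by move=> _ /negPn.
by move=> /negPn.
Qed.

Definition nonincr := pairwise (fun x y => ~~ prec x y).

(** For the rest of a path, [A] is the neighbourhood of the vertex just before it. *)
Definition starts (A : pred nat) (p : seq nat) := if p is x :: _ then A x else true.

Lemma sorted_cons x p : sorted E (x :: p) = starts (E x) p && sorted E p.
Proof. by case: p. Qed.

Lemma sorted_cat x y p q :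
  sorted E (rcons p x ++ y :: q) = [&& sorted E (rcons p x), E x y & sorted E (y :: q)].
Proof.
by case: p => [|z p] //=; rewrite cat_path last_rcons /=.
Qed.

Lemma sorted_rev p : sorted E (rev p) = sorted E p.
Proof. by rewrite rev_sorted; apply: eq_sorted => x y; rewrite Esym. Qed.

Lemma last_has (T : eqType) (P : pred T) s :
  has P s -> exists s1 c s2, [/\ s = s1 ++ c :: s2, P c & ~~ has P s2].
Proof.
elim: s => //= x s IH; case hs: (has P s).
  by have [s1 [c [s2 [-> Pc hs2]]]] := IH hs; exists (x :: s1), c, s2.
by rewrite orbF => Px; exists [::], x, s; rewrite hs.
Qed.

(** Let [c] be the last vertex above the head [h], and reverse the prefix ending in [c]. The vertex
    [a] after [c] is adjacent to [h]: it is not above [h] by the choice of [c], and if it were below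
    [h] it would be below its neighbour [c]. Fewer vertices lie above the new head [c]. *)
Lemma maximal_head (A : pred nat) p :
  uniq p -> sorted E p -> starts A p ->
  {in p &, forall b c, A b -> prec b c -> A c} ->
  exists q, [/\ perm_eq q p, sorted E q, starts A q
              & starts (fun h => all (fun v => ~~ prec h v) q) q].
Proof.
have [k] := ubnP (count (prec (head 0 p)) p); elim: k p => // k IH [|h p] //=.
  by move=> _ _ _ _ _; exists [::].
rewrite prec_irr add0n ltnS => lk /andP[hp up] sp Ah Aup.
case hs: (has (prec h) p); last first.
  exists (h :: p); split=> //=; rewrite prec_irr /=.
  by apply/allP => v vp; apply/negP => hv; move/hasP: hs; case; exists v.
have [s1 [c [s2 [ep hc hs2]]]] := last_has hs.
have pq : perm_eq (c :: rev s1 ++ h :: s2) (h :: p).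
  apply/permP => a; rewrite ep /= !count_cat /= count_rev; lia.
have cp : c \in h :: p by rewrite ep !inE mem_cat inE eqxx !orbT.
have [| | | | |q [qp sq Aq mq]] := IH (c :: rev s1 ++ h :: s2).
- apply: leq_trans lk; rewrite (permP pq) /= -addnS ; rewrite ep !count_cat /=.
  rewrite (negPf (_ : ~~ prec c h)); last by apply/negP => /(precT hc); rewrite prec_irr.
  rewrite prec_irr hc add0n /=.
  have sub s : count (prec c) s <= count (prec h) s.
    by apply: sub_count => v; apply: precT.
  have := sub s1; have := sub s2; lia.
- by rewrite (perm_uniq pq) /= hp.
- have -> : c :: rev s1 ++ h :: s2 = rev (h :: rcons s1 c) ++ s2.
    by rewrite rev_cons rev_rcons cat_rcons.
  have sp' : sorted E (h :: p) := sp; rewrite ep -cat_rcons -cat_cons in sp'.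
  case: s2 ep hs2 pq sp' => [|a s2] ep hs2 pq sp'.
    by rewrite cats0 sorted_rev; move: sp'; rewrite cats0.
  move: sp'; rewrite -rcons_cons sorted_cat => /and3P[sp1 eca sa].
  rewrite rev_cons sorted_cat sa andbT -rev_cons sorted_rev sp1 /=.
  have ha : h != a by apply: contraNneq hp => ->; rewrite ep mem_cat !inE eqxx !orbT.
  apply: incomparable => //; first by move: hs2 => /=; case/norP.
  by apply/negP => ah; have := prec_nadj (precT ah hc); rewrite Esym eca.
- by apply: (Aup h) => //; rewrite inE eqxx.
- by move=> u v; rewrite !(perm_mem pq); apply: Aup.
by exists q; split => //; rewrite -(permPr pq).
Qed.

(** Iterates [maximal_head]. When nothing in the rest lies above [h], the neighbours of [h] in the
    rest are closed upwards, so [E h] can take the role of [A]. *)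
Lemma nonincr_reorder (A : pred nat) p :
  uniq p -> sorted E p -> starts A p ->
  {in p &, forall b c, A b -> prec b c -> A c} ->
  exists q, [/\ perm_eq q p, sorted E q, starts A q & nonincr q].
Proof.
have [k] := ubnP (size p); elim: k A p => // k IH A p lk up sp Ap Aup.
have [[|h q] [qp sq Aq mq]] := maximal_head up sp Ap Aup.
  by exists [::].
have := up; rewrite -(perm_uniq qp) /= => /andP[hq uq].
move: mq => /= /andP[_ mq].
have := sq; rewrite sorted_cons => /andP[hq' sq'].
have [| |q' [qq' sq'' Aq' nq']] := IH (E h) q _ uq sq' hq'.
- by rewrite -(perm_size qp) in lk.
- move=> b c bq cq hb bc; apply: incomparable; first by apply: contraNneq hq => ->.
  + exact: (allP mq).
  + by apply/negP => /(precT bc) /prec_nadj_sym; rewrite hb.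
exists (h :: q'); split=> //.
- by rewrite -(permPr qp) perm_cons.
- by rewrite sorted_cons Aq'.
- by rewrite /nonincr pairwise_cons (perm_all _ qq') mq.
Qed.

(* Reversing the block b, ..., c breaks the path only if the vertex a after it
   lies below b; the LDFS property then yields d, which either extends the path
   or is the end of a later block a, ..., d to be reversed in turn. *)
Lemma reverse_block W X b M c :
  last b M = c ->
  allrel (fun x v => ~~ prec x v) X (b :: M ++ W) -> nonincr (b :: M ++ W) ->
  sorted E (b :: M ++ W) -> uniq (X ++ b :: M ++ W) -> b < c ->
  exists W', sorted E (rev (b :: M) ++ W') /\
    (perm_eq W' W \/ exists2 d, d \notin X ++ b :: M ++ W & perm_eq W' (d :: W)).
Proof.
have [k] := ubnP (size W); elim: k W X b M c => // k IH W X b M c lk eqc.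
rewrite -!cat_cons => aX nB sB uX bc.
case: W lk aX nB sB uX => [|a W] lk aX nB sB uX.
  by exists [::]; rewrite cats0 sorted_rev -(cats0 (b :: M)); split => //; left.
set B := b :: M in aX nB sB uX *.
have BE : B = rcons (belast b M) c by rewrite -eqc -lastI.
have rB : rev B = rcons (rev M) b by rewrite /B rev_cons.
have [srB eca saW] : [/\ sorted E (rev B), E c a & sorted E (a :: W)].
  by move: sB; rewrite BE sorted_cat sorted_rev => /and3P[].
case eba: (E b a).
  exists (a :: W); split; last by left.
  by rewrite rB sorted_cat -rB srB eba.
move: (nB); rewrite /nonincr pairwise_cat => /and3P[aB pB paW].
have bB : b \in B by rewrite inE eqxx.
have cB : c \in B by rewrite -eqc mem_last.
have aW : a \in a :: W by rewrite inE eqxx.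
move: (uX); rewrite cat_uniq => /and3P[_ hX]; rewrite cat_uniq => /and3P[_ hB _].
have ab : prec a b.
  apply: contraFT eba => nab; apply: incomparable => //.
    by apply: contraNneq hB => ba; apply/hasP; exists a; rewrite // -ba.
  exact: (allrelP aB).
have [] := four_points (a := a) (b := b) (c := c); rewrite ?(Esym a) //.
- by case/andP: ab.
- by rewrite eba.
move=> d /andP[ad db] /andP[edb edc].
have dc : prec d c by rewrite /prec edc (ltn_trans db).
(* A non-edge would put [a] below [d], hence below its neighbour [c]. *)
have ead : E d a.
  apply: contraLR eca => eda; rewrite Esym; apply: prec_nadj; apply: precT dc.
  by rewrite /prec ad Esym.
(* Being below [c], the vertex [d] occurs neither in [X] nor in the block: it comes after [c] or not
   at all. *)
have dX : d \notin X.
  by apply/negP => dX; have := allrelP aX d c dX; rewrite mem_cat cB dc => /(_ isT).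
have dB : d \notin B.
  move: pB; rewrite BE pairwise_rcons mem_rcons inE => /andP[pB _].
  rewrite negb_or; apply/andP; split; first by rewrite neq_ltn (ltn_trans db).
  by apply/negP => /(allP pB); rewrite dc.
case dW: (d \in a :: W); last first.
  exists (d :: a :: W); split.
    by rewrite rB sorted_cat -rB srB Esym edb /= ead.
  by right; exists d => //; rewrite !mem_cat (negPf dX) (negPf dB) dW.
have da : d != a by rewrite neq_ltn ad orbT.
move: dW; rewrite inE (negPf da) /= => dW.
have [W1 [W2 eW]] : exists W1 W2, W = W1 ++ d :: W2.
  by case/splitPr: dW => W1 W2; exists W1, W2.
have eqs : X ++ B ++ a :: W = (X ++ B) ++ (a :: rcons W1 d) ++ W2.
  by rewrite eW -catA /= cat_rcons.
have [| | | | | |W' [sW' pW']] := IH W2 (X ++ B) a (rcons W1 d) d _ (last_rcons _ _ _).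
- by move: lk; rewrite eW /= size_cat /=; clear; lia.
- have -> : a :: rcons W1 d ++ W2 = a :: W by rewrite eW /= cat_rcons.
  by rewrite allrel_catl aB andbT; move: aX; rewrite allrel_catr => /andP[].
- have -> : a :: rcons W1 d ++ W2 = a :: W by rewrite eW /= cat_rcons.
  exact: paW.
- by move: saW; rewrite eW /= cat_rcons.
- by rewrite -eqs.
- by [].
exists (rev (a :: rcons W1 d) ++ W'); split.
  move: sW'; rewrite rev_cons rev_rcons /= => sW'.
  by rewrite rB sorted_cat -rB srB Esym edb.
have pr : perm_eq (rev (a :: rcons W1 d) ++ W') (a :: W1 ++ d :: W').
  by rewrite -cat_rcons -cat_cons perm_cat2r perm_rev.
case: pW' => [pW'|[z zX pW']]; [left|right].
  by rewrite (permPl pr) eW perm_cons perm_cat2l perm_cons.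
exists z; first by rewrite eqs.
rewrite (permPl pr) eW; apply/permP => P; move/permP/(_ P): pW' => /=.
by rewrite !count_cat /= => ->; clear; lia.
Qed.

Fixpoint greedy (A : pred nat) (p : seq nat) : bool :=
  if p is c :: q then [&& A c, all (fun v => A v ==> (v <= c)) q & greedy (E c) q]
  else true.

Lemma last_max (A : pred nat) p : has A p ->
  exists2 c, c \in p & A c /\ {in p, forall v, A v -> v <= c}.
Proof.
move=> hA; have exA : exists c, (c \in p) && A c by case/hasP: hA => c ? ?; exists c; apply/andP.
have ubA c : (c \in p) && A c -> c <= \max_(v <- p) v.
  by case/andP => cp _; rewrite (leq_bigmax_seq (F := id)).
case: (ex_maxnP exA ubA) => c /andP[cp Aup] mc; exists c => //; split=> // v vp Av.
by apply: mc; rewrite vp.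
Qed.

(** [X] holds the vertices already placed. In a [nonincr] arrangement of the rest, the largest
    vertex [c] in [A] is brought to the front by [reverse_block], whose outcome with an additional
    vertex is excluded by maximality. The remaining vertices are then treated with [E c] for [A]. *)
Lemma greedy_reorder (A : pred nat) X p :
  allrel (fun x v => ~~ prec x v) X p ->
  {in p &, forall b c, A b -> prec b c -> A c} ->
  sorted E p -> starts A p -> uniq (X ++ p) ->
  (forall d q, d \notin X ++ p -> perm_eq q (d :: p) -> sorted E q -> ~~ starts A q) ->
  exists2 q, perm_eq q p & greedy A q.
Proof.
have [k] := ubnP (size p); elim: k A X p => // k IH A X p lk Xp Aup sp Ap uXp maxp.
have up : uniq p by move: uXp; rewrite cat_uniq => /and3P[].
have [q [qp sq Aq nq]] := nonincr_reorder up sp Ap Aup.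
have Xq : allrel (fun x v => ~~ prec x v) X q.
  by apply/allrelP => x v xX; rewrite (perm_mem qp); apply: (allrelP Xp).
have uXq : uniq (X ++ q) by rewrite (perm_uniq (perm_cat (perm_refl X) qp)).
have Aq' : {in q &, forall b c, A b -> prec b c -> A c}.
  by move=> b c; rewrite !(perm_mem qp); apply: Aup.
have maxq d r : d \notin X ++ q -> perm_eq r (d :: q) -> sorted E r -> ~~ starts A r.
  move=> dX rq; apply: (maxp d).
    by move: dX; rewrite !mem_cat (perm_mem qp).
  by rewrite (permPl rq) perm_cons.
have {}lk : size q < k.+1 by rewrite (perm_size qp).
suff [r rq gr] : exists2 r, perm_eq r q & greedy A r.
  by exists r => //; rewrite (permPl rq).
move: {p qp Xp Aup sp Ap uXp maxp up} q lk Xq Aq' sq Aq uXq maxq nq.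
case=> [|b s] lk Xq Aup sq Ab uXq maxq nq; first by exists [::].
have [|c cq [Acc mc]] := @last_max A (b :: s); first by rewrite /= (Ab : A b).
(* A vertex above [c] would be in [A] too, and at a larger position. *)
have ncv v : v \in b :: s -> ~~ prec c v.
  move=> vq; apply/negP => cv; have := mc v vq (Aup c v cq vq Acc cv).
  by case/andP: cv; lia.
have [r [rq sr]] : exists r, perm_eq (c :: r) (b :: s) /\ sorted E (c :: r).
  move: cq; rewrite inE; case: (altP (c =P b)) => [-> _|cb /= cs].
    by exists s.
  have [s1 [s2 es]] : exists s1 s2, s = s1 ++ c :: s2.
    by case/splitPr: cs => s1 s2; exists s1, s2.
  have eq' : b :: s = b :: rcons s1 c ++ s2 by rewrite es /= cat_rcons.
  have blc : b < c by rewrite ltn_neqAle eq_sym cb; apply: mc; rewrite ?inE ?eqxx.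
  have [| | | | |W [sW pW]] := @reverse_block s2 X b _ c (last_rcons b s1 c).
  - by rewrite -eq'.
  - by rewrite -eq'.
  - by rewrite -eq'.
  - by rewrite -eq'.
  - by [].
  have rB : rev (b :: rcons s1 c) ++ W = c :: (rev s1 ++ b :: W).
    by rewrite rev_cons rev_rcons cat_rcons.
  rewrite rB in sW; exists (rev s1 ++ b :: W); split => //.
  rewrite eq' -rB -cat_cons.
  case: pW => [pW|[d dX pW]].
    by apply: perm_cat; rewrite ?perm_rev.
  have : ~~ starts A (c :: (rev s1 ++ b :: W)).
    apply: (maxq d) => //; first by rewrite eq'.
    rewrite eq' -rB -cat_cons -(cat1s d) perm_sym perm_catCA perm_sym.
    by apply: perm_cat; rewrite ?perm_rev.
  by rewrite /= Acc.
have rU : uniq (c :: r) by rewrite (perm_uniq rq); move: uXq; rewrite cat_uniq => /and3P[].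
have ncr v : v \in c :: r -> ~~ prec c v by rewrite (perm_mem rq); apply: ncv.
have sr' := sr; rewrite sorted_cons in sr'; case/andP: sr' => cr sr'.
have rX : perm_eq (rcons X c ++ r) (X ++ b :: s) by rewrite cat_rcons perm_cat2l.
have rsub v : v \in r -> v \in b :: s by rewrite -(perm_mem rq) inE orbC => ->.
have [| | | | | | |r' r'r gr'] := IH (E c) (rcons X c) r.
- by move: lk; rewrite -(perm_size rq).
- apply/allrelP => x v; rewrite mem_rcons inE => /orP[/eqP -> vr|xX vr].
    by apply: ncr; rewrite inE vr orbT.
  by apply: (allrelP Xq) => //; apply: rsub.
- move=> u v ur vr cu uv; apply: incomparable.
  + by apply: contraTneq rU => ->; rewrite /= vr.
  + by apply: ncr; rewrite inE vr orbT.
  + by apply/negP => /(precT uv) /prec_nadj_sym; rewrite cu.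
- exact: sr'.
- exact: cr.
- by rewrite (perm_uniq rX).
- move=> d t dX td st; apply/negP => ct.
  have : ~~ starts A (c :: t).
    apply: (maxq d); first by rewrite -(perm_mem rX).
      move: rq td; rewrite -(perm_cons d) -(perm_cons c t) => rq td.
      by apply: perm_trans td _; rewrite -(permPr rq) -(cat1s c) -(cat1s d) perm_catCA.
    by rewrite sorted_cons ct.
  by rewrite /= Acc.
exists (c :: r'); first by rewrite -(permPr rq) perm_cons.
rewrite /= Acc gr' andbT; apply/allP => v vr; apply/implyP; apply: mc.
by apply: rsub; rewrite -(perm_mem r'r).
Qed.

(** A vertex above the head [c] would be in [A] at a larger position, and so be preferred to [c].
    Hence the neighbours of [c] in the rest are again closed upwards. *)
Lemma greedy_nonincr (A : pred nat) p : uniq p ->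
  {in p &, forall b c, A b -> prec b c -> A c} -> greedy A p -> nonincr p.
Proof.
elim: p A => // c p IH A /= /andP[cp up] Aup /and3P[Acc mc gp].
have ncp v : v \in p -> ~~ prec c v.
  move=> vp; apply/negP => cv; have := allP mc v vp.
  by rewrite (Aup c v) ?inE ?eqxx ?vp ?orbT //=; case/andP: cv; lia.
apply/andP; split; first exact/allP.
apply: (IH (E c)) => // u v u_p vp cu uv; apply: incomparable.
- by apply: contraNneq cp => ->.
- exact: ncp.
- by apply/negP => /(precT uv) /prec_nadj_sym; rewrite cu.
Qed.

Lemma greedy_starts A p : greedy A p -> starts A p.
Proof. by case: p => //= c p /and3P[]. Qed.

Lemma greedy_prefix A p q : greedy A (p ++ q) -> greedy A p.
Proof.
elim: p A => // c p IH A /= /and3P[-> +  gp].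
by rewrite all_cat (IH _ gp) => /andP[-> _].
Qed.

Lemma greedy_suffix A p x q : greedy A (rcons p x ++ q) -> greedy (E x) q.
Proof. by elim: p A => [|c p IH] A /= /and3P[_ _] //; apply: IH. Qed.

(** Makes the part after the smallest position a greedy path in its own right, since all of it is
    adjacent to that position. *)
Lemma greedy_weaken A p : all A p -> greedy A p -> greedy predT p.
Proof.
case: p => //= c p /andP[_ Ap] /and3P[_ mc ->]; rewrite andbT.
by apply/allP => v vp /=; have := allP mc v vp; rewrite (allP Ap).
Qed.

End Greedy.

(** * The dynamic program *)

Section Dynamic.

Variables (E : rel nat) (n : nat).
Local Notation prec := (prec E).

(* j = n plays the role of a vertex above all others. *)
Definition below (j v : nat) := (j == n) || prec v j.

Section Step.

Variables (pr : nat -> nat -> seq nat) (i j k : nat).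

(* pr j k is the best path so far below j with end k, for vertices after i;
   x = n means that i is not used.  For k = i the second part is empty, and
   x = i, for which the first part is empty too, gives the path [:: i]. *)
Definition join (x : nat) := if x == n then pr j k else pr j x ++ i :: pr x k.

(** An empty sequence means that no path is recorded. For [k = i] this is harmless, as the result
    ends in [i] anyway; otherwise both parts have to exist. *)
Definition joinable (x : nat) :=
  [&& below j i, (x == i) || E x i
    & (k == i) || (0 < size (pr j x)) && (0 < size (pr x k))].

(** Written as a scan with a strict comparison, so that it is the state of the loop in [search]
    after [x] rounds. *)
Fixpoint argbest (x : nat) : nat :=
  if x isn't y.+1 then n else
  if joinable y && (size (join (argbest y)) < size (join y)) then y else argbest y.

Lemma argbestP x : x <= n ->
  argbest x = n \/ (argbest x < n) && joinable (argbest x).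
Proof.
elim: x => [|x IH] xn /=; first by left.
by case: ifP => [/andP[jx _]|_]; [right; rewrite xn jx|apply: IH; apply: ltnW].
Qed.

Lemma argbest_max x y : y < x -> joinable y -> size (join y) <= size (join (argbest x)).
Proof.
elim: x => // x IH; rewrite ltnS leq_eqVlt => /orP[/eqP <-|yx] jy /=.
  by rewrite jy /=; case: leqP.
by case: ifP => [/andP[_ /ltnW]|_]; [apply: leq_trans|]; apply: IH.
Qed.

Lemma argbest_ge x : size (pr j k) <= size (join (argbest x)).
Proof.
elim: x => [|x IH] /=; first by rewrite /join eqxx.
by case: ifP => // /andP[_ /ltnW]; apply: leq_trans.
Qed.

End Step.

(* The best path among the last m positions. *)
Fixpoint best (m : nat) : nat -> nat -> seq nat :=
  if m isn't m'.+1 then fun _ _ => [::] else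
  fun j k => join (best m') (n - m) j k (argbest (best m') (n - m) j k n).

Hypothesis Esym : symmetric E.
Hypothesis precT : transitive prec.

(** [valid_end] is the one consequence of greediness that joining needs: a part with no vertex below
    its end [x] is disjoint from every part that lies below [x]. *)
Record valid (m j k : nat) (p : seq nat) : Prop := Valid {
  valid_range : {in p, forall v, n - m <= v < n};
  valid_below : all (below j) p;
  valid_uniq : uniq p;
  valid_sorted : sorted E p;
  valid_last : last n p = k;
  valid_end : {in p, forall v, ~~ prec v k} }.

Lemma prec_below j u v : prec u v -> below j v -> below j u.
Proof.
rewrite /below; case: eqP => //= _ uv; exact: precT.
Qed.

Lemma best_valid m j k : m <= n -> best m j k != [::] -> valid m j k (best m j k).
Proof.
elim: m j k => // m IH j k mn; set i := n - m.+1; rewrite /=.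
have {}IH j' k' := IH j' k' (ltnW mn).
have im : n - m = i.+1 by rewrite /i; lia.
have i_n : i < n by rewrite /i; lia.
have memk j' k' : best m j' k' != [::] -> k' \in best m j' k'.
  move=> h; have := valid_last (IH _ _ h).
  by case: (best _ _ _) h => //= v s _ <-; rewrite mem_last.
have out j' : best m j' i = [::].
  apply/eqP; apply/negPn/negP => h; have := valid_range (IH _ _ h) (memk _ _ h).
  by rewrite im; lia.
have up v j' k' : v \in best m j' k' -> i < v < n.
  move=> vb; have h : best m j' k' != [::] by apply: contraTneq vb => ->.
  by have := valid_range (IH _ _ h) vb; rewrite im.
have [->|/andP[]] := argbestP (best m) i j k (leqnn n).
  rewrite /join eqxx => h; have [h1 h2 h3 h4 h5 h6] := IH _ _ h.
  by split=> // v /h1; rewrite im -/i; lia.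
move: (argbest _ _ _ _ _) => x xn /and3P[ij xi ki] _; rewrite /join ltn_eqF //.
have iNb j' k' : i \notin best m j' k' by apply/negP => /up; rewrite ltnn.
have endi s : {in s, forall v, i <= v} -> {in s, forall v, ~~ prec v i}.
  by move=> h v /h; rewrite /prec; case: ltngtP => //; lia.
case: (altP (k =P i)) ki => [-> _|_ /= /andP[]].
  (* The second part is empty: its end would be [i], which is out of range. *)
  rewrite out cats1.
  have [b0|b0] := eqVneq (best m j x) [::].
    rewrite b0; split=> //=; rewrite ?ij // => v; rewrite inE => /eqP -> //; first by rewrite leqnn.
    by rewrite prec_irr.
  have [h1 h2 h3 h4 h5 h6] := IH _ _ b0.
  have xi' : E x i.
    by case/orP: xi => // /eqP xi; have := memk _ _ b0; rewrite xi (negPf (iNb _ _)).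
  split.
  - by move=> v; rewrite mem_rcons inE => /orP[/eqP ->|/h1]; rewrite -/i; lia.
  - by rewrite all_rcons ij.
  - by rewrite rcons_uniq iNb.
  - move: h4 h5; case: (best m j x) b0 => //= v s _ h4 h5.
    by rewrite rcons_path h4 h5.
  - by rewrite last_rcons.
  - by apply: endi => v; rewrite mem_rcons inE => /orP[/eqP ->|/up]; lia.
rewrite !lt0n !size_eq0 => b1 b2.
have [h1 h2 h3 h4 h5 h6] := IH _ _ b1; have [g1 g2 g3 g4 g5 g6] := IH _ _ b2.
have xb := memk _ _ b1; have kb := memk _ _ b2.
have xi' : E x i.
  by case/orP: xi => // /eqP xi; move: xb; rewrite xi (negPf (iNb _ _)).
have vx v : v \in best m x k -> prec v x.
  by move/(allP g2); rewrite /below ltn_eqF.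
(* A non-edge would put [i] below [v], hence below its neighbour [x]. *)
have iv v : v \in best m x k -> E i v.
  move=> vb; have /andP[lv _] := up _ _ _ vb; apply: incomparable => //.
  - by rewrite neq_ltn lv.
  - by apply/negP => /precT /(_ (vx v vb)) /(prec_nadj_sym Esym); rewrite xi'.
  - by rewrite /prec; case: ltngtP lv => //.
split.
- by move=> v; rewrite mem_cat inE -/i =>
    /or3P[/up/andP[/ltnW-> ->]|/eqP->|/up/andP[/ltnW-> ->]] //; rewrite leqnn.
- rewrite all_cat /= h2 ij /=; apply/allP => v /vx /prec_below; apply.
  exact: (allP h2).
- rewrite cat_uniq h3 /= -/i !(negPf (iNb _ _)) g3 /= andbT.
  apply/hasPn => v /vx vx'; apply/negP => /h6; by rewrite vx'.
- have -> : best m j x = rcons (belast (head 0 (best m j x)) (behead (best m j x))) x.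
    by move: h5; case: (best m j x) b1 => //= v s _ <-; rewrite -lastI.
  rewrite sorted_cat xi' sorted_cons g4 andbT; apply/andP; split.
    by move: h4 h5; case: (best m j x) b1 => //= v s _ vs <-; rewrite -lastI.
  by case: (best m x k) iv => //= v s; apply; rewrite inE eqxx.
- by rewrite last_cat /=; case: (best m x k) b2 g5.
- move=> v; rewrite mem_cat inE => /or3P[vb|/eqP ->|]; last exact: g6.
    apply/negP => /precT /(_ (vx k kb)); apply/negP; exact: h6.
  by apply/negP => /prec_nadj; rewrite iv.
Qed.

Lemma size_best m j k : m <= n -> size (best m j k) <= n.
Proof.
move=> mn; have [->//|h] := eqVneq (best m j k) [::].
have [h1 _ h3 _ _ _] := best_valid mn h.
rewrite -(size_iota 0 n); apply: uniq_leq_size => // v /h1.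
by rewrite mem_iota; lia.
Qed.

(** Cutting a greedy path at its smallest position leaves two greedy paths, to which the induction
    hypothesis applies. *)
Lemma best_complete m j k p : m <= n ->
  {in p, forall v, n - m <= v < n} -> all (below j) p -> uniq p ->
  greedy E predT p -> last n p = k -> size p <= size (best m j k).
Proof.
elim: m j k p => [|m IH] j k p mn pr pb pu pg pl.
  by case: p pr {pb pu pg pl} => // v p /(_ v); rewrite inE eqxx subn0 => /(_ isT); lia.
have {}IH := IH _ _ _ (ltnW mn); rewrite /=; set i := n - m.+1.
have im : n - m = i.+1 by rewrite /i; lia.
case ip: (i \in p); last first.
  apply: leq_trans (argbest_ge _ _ _ _ _); apply: IH => // v vp.
  have := pr v vp; have : v != i by apply: contraFneq ip => <-.
  by rewrite -/i im; lia.
have [p1 [p2 ep]] : exists p1 p2, p = p1 ++ i :: p2.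
  by case/splitPr: ip => p1 p2; exists p1, p2.
have i_n : i < n by rewrite /i; lia.
have pi v : v \in p1 ++ p2 -> i < v < n.
  move=> vp; have vp' : v \in p by move: vp; rewrite ep !mem_cat inE => /orP[] -> //; rewrite !orbT.
  have := pr v vp'; suff : v != i by rewrite -/i; lia.
  apply: contraTneq pu => vi; rewrite ep -cat1s uniq_catCA /=.
  by rewrite -vi vp.
have ij : below j i by apply: (allP pb).
have nr : nonincr E p by apply: greedy_nonincr pg => //.
rewrite ep in pb pu pg pl nr *.
move: pl; rewrite last_cat /= => pl.
case: (lastP p1) => [|q x] in pi ep pb pu pg nr *.
  (* A greedy path starts with its largest position; if this is also the smallest one, there is no
     other vertex. *)
  rewrite /= in pi pg *; case: p2 pi pl pg {ep pb pu nr} => [|v p2] pi pl pg.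
    apply: leq_trans (argbest_max (y := i) _ _) => //.
      by rewrite /join ltn_eqF // size_cat /= addnS.
    by rewrite /joinable ij eqxx /= -pl eqxx.
  have /pi : v \in v :: p2 by rewrite inE eqxx.
  by move: pg => /= /andP[]; case/andP => +; lia.
move: pu; rewrite cat_uniq => /and3P[u1 hp /= /andP[_ u2]].
move: (nr); rewrite /nonincr pairwise_cat => /and3P[nr12 _ _].
have gx : greedy E (E x) (i :: p2) by apply: greedy_suffix pg.
have xi : E x i by move: gx => /= /and3P[].
have xn : x < n by have /pi/andP[] : x \in rcons q x ++ p2 by rewrite mem_cat mem_rcons inE eqxx.
have s1 : size (rcons q x) <= size (best m j x).
  apply: IH => //.
  - by move=> v vq; rewrite im; apply: pi; rewrite mem_cat vq.
  - by move: pb; rewrite all_cat => /andP[].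
  - exact: greedy_prefix pg.
  - by rewrite last_rcons.
have x_p1 : x \in rcons q x by rewrite mem_rcons inE eqxx.
(* As [v] comes after [x], it is not above [x]; if it were adjacent to [x], the path would have gone
   from [x] to a position at least [v] rather than to [i]. *)
have p2x v : v \in p2 -> prec v x.
  move=> vp; have /andP[iv _] : i < v < n by apply: pi; rewrite mem_cat vp orbT.
  have vi : v \in i :: p2 by rewrite inE vp orbT.
  have xv : x != v.
    by apply: contraNneq hp => xv; apply/hasP; exists v; rewrite // -xv.
  apply/negPn/negP => nvx; have := incomparable Esym xv (allrelP nr12 _ _ x_p1 vi) nvx.
  by move: gx => /= /and3P[_ /allP/(_ v vp)]; case: (E x v); rewrite //= leqNgt iv.
have s2 : p2 != [::] -> size p2 <= size (best m x k).
  move=> p20; apply: IH => //.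
  - by move=> v vp; rewrite im; apply: pi; rewrite mem_cat vp orbT.
  - by apply/allP => v /p2x; rewrite /below orbC => ->.
  - apply: (@greedy_weaken _ (E i)); last by move: gx => /= /and3P[].
    apply/allP => v vp; have /andP[iv _] : i < v < n by apply: pi; rewrite mem_cat vp orbT.
    apply: incomparable => //; first by rewrite neq_ltn iv.
    + by apply/negP => /precT/(_ (p2x v vp))/(prec_nadj_sym Esym); rewrite xi.
    + by rewrite /prec; case: ltngtP iv.
  - by case: (p2) p20 pl.
have jx : joinable (best m) i j k x.
  rewrite /joinable ij xi orbT /=; case: (altP (k =P i)) => //= ki.
  have p20 : p2 != [::] by apply: contraNneq ki => p20; rewrite -pl p20.
  rewrite (leq_trans _ s1) ?size_rcons // (leq_trans _ (s2 p20)) //.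
  by rewrite lt0n size_eq0.
apply: leq_trans (argbest_max xn jx).
rewrite /join ltn_eqF // !size_cat /= !addnS ltnS leq_add //.
by have [-> //|/s2] := eqVneq p2 [::].
Qed.

End Dynamic.

(** * Reasoning about word RAM programs *)

(* An upper bound for the running time when every loop does at most N rounds. *)
Fixpoint ctime (N : nat) (c : com) : nat :=
  match c with
  | Skip => 1
  | Assign _ e => (cost e).+1
  | Put _ i e => (cost i + cost e).+1
  | Seq c1 c2 => ctime N c1 + ctime N c2
  | If b c1 c2 => (cost b + (ctime N c1 + ctime N c2)).+1
  | While b c => (N * (cost b + ctime N c).+1 + cost b).+1
  end.

Fixpoint depth (c : com) : nat :=
  match c with
  | Skip | Assign _ _ | Put _ _ _ => 0
  | Seq c1 c2 | If _ c1 c2 => maxn (depth c1) (depth c2)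
  | While _ c => (depth c).+1
  end.

(** Each nested loop contributes a factor [N], and [ctime 1 c] collects the constants, so the degree
    can be read off the syntax. *)
Lemma ctime_poly N c d :
  0 < N -> depth c <= d -> ctime N c <= ctime 1 c * N ^ d.
Proof.
move=> N0.
elim: c d => [|x e|a i e|c1 IH1 c2 IH2|b c1 IH1 c2 IH2|b c IH] d /=;
  have Nd k : 0 < N ^ k by rewrite expn_gt0 N0.
1-3: by move=> _; rewrite leq_pmulr.
1-2: rewrite geq_max => /andP[/IH1 h1 /IH2 h2].
- by rewrite mulnDl leq_add.
- have := leq_pmulr (cost b).+1 (Nd d); lia.
case: d => // d /IH h; rewrite expnS.
have := leq_pmulr (cost b).+1 (Nd d.+1); have := leq_pmulr (cost b).+1 (Nd d).
rewrite expnS => h1 h2.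
have : N * (cost b + ctime N c).+1 <= N * ((cost b).+1 * N ^ d + ctime 1 c * N ^ d).
  by rewrite leq_mul2l; apply/orP; right; lia.
nia.
Qed.

Fixpoint value (s : state) (e : expr) : nat :=
  match e with
  | Defs.Num c => c
  | Var x => var s x
  | Get a i => arr s a (value s i)
  | Bin o e1 e2 => binop_sem o (value s e1) (value s e2)
  end.

(** Collects the overflow conditions of all subexpressions, so that [value] can be computed without
    options. *)
Fixpoint fits (B : nat) (s : state) (e : expr) : Prop :=
  match e with
  | Defs.Num c => c < B
  | Var x => var s x < B
  | Get a i => fits B s i /\ arr s a (value s i) < B
  | Bin o e1 e2 =>
    [/\ fits B s e1, fits B s e2 & binop_sem o (value s e1) (value s e2) < B]
  end.

Lemma eval_value B s e : fits B s e -> eval B s e = Some (value s e).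
Proof.
elim: e => [c|x|a i IH|o e1 IH1 e2 IH2] /=; rewrite /word.
1-2: by move=> ->.
- by move=> [/IH -> ->].
- by move=> [/IH1 -> /IH2 -> ->].
Qed.

Definition same (xs bs : seq nat) (s s' : state) : Prop :=
  (forall y, y \notin xs -> var s' y = var s y) /\
  (forall a j, a \notin bs -> arr s' a j = arr s a j).

Lemma same_trans xs bs s1 s2 s3 : same xs bs s1 s2 -> same xs bs s2 s3 -> same xs bs s1 s3.
Proof.
move=> [h1 h2] [g1 g2]; split=> [y ys|a j aj]; first by rewrite g1 ?h1.
by rewrite g2 ?h2.
Qed.

Lemma same_sub xs bs xs' bs' s s' : all [in xs'] xs -> all [in bs'] bs ->
  same xs bs s s' -> same xs' bs' s s'.
Proof.
move=> /allP hx /allP hb [h1 h2]; split=> [y ys|a j ab].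
  by apply: h1; apply: contra ys; apply: hx.
by apply: h2; apply: contra ab; apply: hb.
Qed.

Lemma same_set_var xs bs s s' x v : x \in xs -> same xs bs s s' ->
  same xs bs s (set_var s' x v).
Proof.
move=> xx [h1 h2]; split=> //= y ys; case: eqP ys => [->|_]; last exact: h1.
by rewrite xx.
Qed.

Lemma same_set_arr xs bs s s' a i v : a \in bs -> same xs bs s s' ->
  same xs bs s (set_arr s' a i v).
Proof.
move=> aa [h1 h2]; split=> //= b j bb; case: eqP bb => [->|_]; last exact: h2.
by rewrite aa.
Qed.

Section Run.

Variables (B N : nat).

(** Total correctness with a time bound fixed by the syntax of [c]: proofs about particular programs
    never count steps. *)
Definition run (c : com) (s : state) (Q : state -> Prop) : Prop :=
  exists t s', [/\ exec B c s t s', t <= ctime N c & Q s'].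

Lemma run_skip s (Q : state -> Prop) : Q s -> run Skip s Q.
Proof. by move=> q; exists 1, s; split=> //; apply: ExecSkip. Qed.

Lemma run_assign x e s (Q : state -> Prop) :
  fits B s e -> Q (set_var s x (value s e)) -> run (Assign x e) s Q.
Proof.
by move=> /eval_value h q; eexists; eexists; split; [apply: ExecAssign h| |].
Qed.

Lemma run_put a i e s (Q : state -> Prop) : fits B s i -> fits B s e ->
  Q (set_arr s a (value s i) (value s e)) -> run (Put a i e) s Q.
Proof.
move=> /eval_value hi /eval_value he q.
by eexists; eexists; split; [apply: ExecPut hi he| |].
Qed.

Lemma run_seq c1 c2 s Q :
  run c1 s (fun s' => run c2 s' Q) -> run (Seq c1 c2) s Q.
Proof.
move=> [t1 [s1 [h1 l1 [t2 [s2 [h2 l2 q]]]]]].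
by eexists; eexists; split; [apply: ExecSeq h1 h2|apply: leq_add|].
Qed.

Lemma run_if b c1 c2 s Q : fits B s b ->
  (value s b != 0 -> run c1 s Q) -> (value s b = 0 -> run c2 s Q) ->
  run (If b c1 c2) s Q.
Proof.
move=> /eval_value hb h1 h2.
have [t [s' [h l q]]] : exists t s',
    [/\ exec B (if value s b != 0 then c1 else c2) s t s',
        t <= ctime N c1 + ctime N c2 & Q s'].
  case: (altP (value s b =P 0)) => [/h2|/h1] [t [s' [h l q]]]; exists t, s'; split=> //.
    by apply: leq_trans l _; rewrite leq_addl.
  by apply: leq_trans l _; rewrite leq_addr.
by eexists; eexists; split; [apply: ExecIf hb h|rewrite /= ltnS leq_add2l|].
Qed.

Lemma run_weaken c s (Q Q' : state -> Prop) :
  run c s Q -> (forall s', Q s' -> Q' s') -> run c s Q'.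
Proof. by move=> [t [s' [h l q]]] /(_ _ q) q'; exists t, s'. Qed.

Definition For (x : nat) (e : expr) (c : com) : com :=
  Seq (Assign x (Defs.Num 0))
    (While (Bin Lt (Var x) e) (Seq c (Assign x (Bin Add (Var x) (Defs.Num 1))))).

Lemma run_for x e c k (I : nat -> state -> Prop) s (Q : state -> Prop) :
  k <= N -> 1 < B -> k < B ->
  I 0 (set_var s x 0) ->
  (forall i s', i <= k -> var s' x = i -> I i s' -> fits B s' e /\ value s' e = k) ->
  (forall i s', i < k -> var s' x = i -> I i s' ->
     run c s' (fun s'' => var s'' x = i /\ I i.+1 (set_var s'' x i.+1))) ->
  (forall s', var s' x = k -> I k s' -> Q s') ->
  run (For x e c) s Q.
Proof.
move=> kN B1 kB I0 he hc hQ; apply: run_seq; apply: run_assign; first by apply: ltnW.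
set b := Bin Lt _ _; set c' := Seq _ _.
suff H : forall r i s', i + r = k -> var s' x = i -> I i s' ->
    exists t s'', [/\ exec B (While b c') s' t s'',
      t <= (r * (cost b + ctime N c').+1 + cost b).+1 & Q s''].
  have [] := H k 0 (set_var s x 0) => //=; first by rewrite eqxx.
  move=> t [s' [h l q]]; exists t, s'; split=> //; apply: leq_trans l _.
  by rewrite ltnS leq_add2r leq_mul2r kN orbT.
elim=> [|r IH] i s' ir xi Ii.
  rewrite addn0 in ir; rewrite {}ir in xi Ii.
  have [fe ve] := he _ s' (leqnn k) xi Ii.
  have fb : fits B s' b by split=> //=; rewrite ?xi // ve ltnn ltnW.
  exists (cost b).+1, s'; split=> //; last exact: hQ.
  by apply: ExecWhileFalse; rewrite (eval_value fb) /= ve xi ltnn.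
have ik : i < k by rewrite -ir addnS ltnS leq_addr.
have [fe ve] := he _ s' (ltnW ik) xi Ii.
have fb : fits B s' b.
  by split=> //=; [rewrite xi (leq_trans ik) // ltnW|rewrite ve xi ik].
have [t1 [s1 [h1 l1 [x1 I1]]]] := hc _ _ ik xi Ii.
have [|||t2 [s2 [h2 l2 q2]]] := IH i.+1 (set_var s1 x i.+1).
- by rewrite addSnnS.
- by rewrite /= eqxx.
- by [].
have f1 : fits B s1 (Bin Add (Var x) (Defs.Num 1)).
  by split; rewrite //= x1 ?addn1; [apply: leq_trans ik _; apply: ltnW|apply: leq_ltn_trans ik _].
have f1' : exec B c' s' (t1 + (cost (Bin Add (Var x) (Defs.Num 1))).+1) (set_var s1 x i.+1).
  rewrite (_ : i.+1 = value s1 (Bin Add (Var x) (Defs.Num 1))); last by rewrite /= x1 addn1.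
  exact: ExecSeq h1 (ExecAssign _ (eval_value f1)).
eexists; exists s2; split; last exact: q2.
  by refine (ExecWhileTrue (eval_value fb) _ f1' h2); rewrite /= ve xi ik.
rewrite /=; move: l1 l2 => /=; set a := r * _; lia.
Qed.

End Run.

(** * The program *)

Local Notation num := Defs.Num.
Local Notation "a :+: b" := (Bin Add a b) (at level 50, left associativity).
Local Notation "a :-: b" := (Bin Defs.Sub a b) (at level 50, left associativity).
Local Notation "a :*: b" := (Bin Mul a b) (at level 40, left associativity).
Local Notation "a :==: b" := (Bin Eq a b) (at level 70).
Local Notation "a :<: b" := (Bin Lt a b) (at level 70).
Local Notation "c ;; d" := (Seq c d) (at level 90, right associativity).
Local Notation "x ::= e" := (Assign x e) (at level 75).

(** The arguments are positions, which array 1 translates into vertices. *)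
Definition edge (u v : expr) : expr := Get 0 (Get 1 u :*: Var 0 :+: Get 1 v).

Definition cell (m j k : expr) : expr :=
  (m :*: (Var 0 :+: num 1) :+: j) :*: (Var 0 :+: num 1) :+: k.

Arguments edge : simpl never.
Arguments cell : simpl never.

Lemma value_var s x : value s (Var x) = var s x.
Proof. by []. Qed.

Lemma value_get s a e : value s (Get a e) = arr s a (value s e).
Proof. by []. Qed.

Lemma value_bin s o e1 e2 : value s (Bin o e1 e2) = binop_sem o (value s e1) (value s e2).
Proof. by []. Qed.

(* Array 2 holds the lengths and array 3 the vertices of the paths best m j k.
   Variables: 1 = m, 2 = j, 3 = k, 4 = x, 5 = length of the best path,
   6 = its x (or n), 8 and 9 = lengths of the two parts, 12 = i. *)
Definition guard : expr :=
  ((Var 2 :==: Var 0) :+: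
     (Var 12 :<: Var 2) :*: (edge (Var 12) (Var 2) :==: num 0)) :*:
  ((Var 4 :==: Var 12) :+: edge (Var 4) (Var 12)) :*:
  ((Var 3 :==: Var 12) :+: Var 8 :*: Var 9) :*:
  (Var 5 :<: Var 8 :+: Var 9 :+: num 1).

Definition search : com :=
  5 ::= Get 2 (cell (Var 1) (Var 2) (Var 3)) ;;
  6 ::= Var 0 ;;
  For 4 (Var 0)
    (8 ::= Get 2 (cell (Var 1) (Var 2) (Var 4)) ;;
     9 ::= Get 2 (cell (Var 1) (Var 4) (Var 3)) ;;
     If guard (5 ::= Var 8 :+: Var 9 :+: num 1 ;; 6 ::= Var 4)
       Skip).

(* Variables: 8 = length of the first part, 9 and 10 = positions of the two
   parts in array 3, 11 = position of the result. *)
Definition copy : com :=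
  For 7 (Var 5)
    (If (Var 7 :<: Var 8)
       (Put 3 (Var 11 :+: Var 7) (Get 3 (Var 9 :+: Var 7)))
       (If (Var 7 :==: Var 8)
          (Put 3 (Var 11 :+: Var 7) (Var 12))
          (Put 3 (Var 11 :+: Var 7)
             (Get 3 (Var 10 :+: (Var 7 :-: Var 8 :-: num 1)))))).

Definition store : com :=
  If (Var 6 :==: Var 0)
    (8 ::= Var 5 ;;
     9 ::= cell (Var 1) (Var 2) (Var 3) :*: (Var 0 :+: num 1))
    (8 ::= Get 2 (cell (Var 1) (Var 2) (Var 6)) ;;
     9 ::= cell (Var 1) (Var 2) (Var 6) :*: (Var 0 :+: num 1) ;;
     10 ::= cell (Var 1) (Var 6) (Var 3) :*: (Var 0 :+: num 1)) ;;
  11 ::= cell (Var 1 :+: num 1) (Var 2) (Var 3) :*: (Var 0 :+: num 1) ;;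
  copy ;;
  Put 2 (cell (Var 1 :+: num 1) (Var 2) (Var 3)) (Var 5).

Definition fill : com :=
  For 1 (Var 0)
    (12 ::= Var 0 :-: Var 1 :-: num 1 ;;
     For 2 (Var 0 :+: num 1)
       (For 3 (Var 0 :+: num 1) (search ;; store))).

Definition extract : com :=
  6 ::= num 0 ;;
  5 ::= Get 2 (cell (Var 0) (Var 0) (Var 6)) ;;
  For 3 (Var 0 :+: num 1)
    (If (Var 5 :<: Get 2 (cell (Var 0) (Var 0) (Var 3)))
       (5 ::= Get 2 (cell (Var 0) (Var 0) (Var 3)) ;; 6 ::= Var 3)
       Skip) ;;
  9 ::= cell (Var 0) (Var 0) (Var 6) :*: (Var 0 :+: num 1) ;;
  For 7 (Var 5) (Put 0 (Var 7) (Get 1 (Get 3 (Var 9 :+: Var 7)))) ;;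
  0 ::= Var 5.

(** * Correctness of the table computation and of the output *)

Section Fill.

Variables (E : rel nat) (n B : nat).
Let M := n.+1.
(** Array 3 consists of [M * M * M] blocks of length [M]. The factor 16 leaves room for the bound
    [4 * (M * M)] on guards, also when [M = 1]. *)
Hypothesis HB : 16 * (M * M * M * M) <= B.
Hypothesis best_size : forall m j k, m <= n -> size (best E n m j k) <= n.
Hypothesis best_lt : forall m j k, m <= n -> all (gtn n) (best E n m j k).

Local Notation run := (run B M).
Local Notation best := (best E n).

(* The path best m j k is stored from cell idx m j k * M of array 3. *)
Definition idx (m j k : nat) := (m * M + j) * M + k.

Lemma idx_lt m j k : m <= n -> j <= n -> k <= n -> idx m j k < M * M * M.
Proof. by rewrite /idx /M => *; nia. Qed.

Lemma M2_lt x : x <= 4 * (M * M) -> x < B.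
Proof. by move=> h; apply: leq_trans HB; rewrite /M in h *; nia. Qed.

Lemma le_fits x : x <= M -> x < B.
Proof. by move=> h; apply: M2_lt; rewrite /M in h *; nia. Qed.

Lemma pos_fits b p : b < M * M * M -> p <= n -> b * M + p < B.
Proof.
move=> hb hp; apply: leq_trans HB; apply: (@leq_trans (b.+1 * M)).
  by rewrite /M; nia.
by rewrite (leq_trans (leq_mul hb (leqnn M))) // leq_pmull.
Qed.

(** The bound on array 1 includes position [n]. Expressions are evaluated without short-circuit, so
    the guard looks up the edge between [i] and [j] even for [j = n], and this access must not
    overflow. *)
Definition ready (s : state) : Prop :=
  [/\ var s 0 = n, forall u, u <= n -> arr s 1 u <= n, forall u, arr s 0 u <= 1
    & forall u v, u < n -> v < n -> arr s 0 (arr s 1 u * n + arr s 1 v) = E u v].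

Lemma ready_same xs bs s s' : 0 \notin xs -> 0 \notin bs -> 1 \notin bs ->
  same xs bs s s' -> ready s -> ready s'.
Proof.
move=> x0 b0 b1 [hv ha] [h0 h1 h2 h3]; split.
- by rewrite hv.
- by move=> u; rewrite ha //; apply: h1.
- by move=> u; rewrite ha.
- by move=> u v; rewrite !(ha 1) // (ha 0) //; apply: h3.
Qed.

Lemma cell_ok s e1 e2 e3 m j k : var s 0 = n ->
  fits B s e1 -> fits B s e2 -> fits B s e3 ->
  value s e1 = m -> value s e2 = j -> value s e3 = k ->
  m <= n -> j <= n -> k <= n ->
  fits B s (cell e1 e2 e3) /\ value s (cell e1 e2 e3) = idx m j k.
Proof.
move=> v0 f1 f2 f3 v1 v2 v3 mn jn kn; rewrite /cell /= v0 v1 v2 v3 addn1; split=> //.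
have n_B : n < B by apply: le_fits; apply: leqnSn.
have M_B : M < B by apply: le_fits.
have one_B : 1 < B by apply: le_fits.
have := idx_lt mn jn kn; have := pos_fits (idx_lt mn jn kn) (leq0n n).
rewrite /idx => h1 h2.
have hb : (m * M + j) * M + k < B.
  by apply: leq_ltn_trans h1; rewrite addn0 leq_pmulr.
have h3 : (m * M + j) * M < B by apply: leq_ltn_trans hb; rewrite leq_addr.
have h4 : m * M + j < B by apply: leq_ltn_trans h3; rewrite leq_pmulr.
have h5 : m * M < B by apply: leq_ltn_trans h4; rewrite leq_addr.
by do !split.
Qed.

Lemma edge_ok s e1 e2 u v : ready s -> fits B s e1 -> fits B s e2 ->
  value s e1 = u -> value s e2 = v -> u <= n -> v <= n ->
  fits B s (edge e1 e2).
Proof.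
move=> [h0 h1 h2 h3] f1 f2 v1 v2 un vn; rewrite /edge /= h0 v1 v2.
have := h1 _ un; have := h1 _ vn; move: (arr s 1 u) (arr s 1 v) => a b ha hb.
have n_B : n < B by apply: le_fits; apply: leqnSn.
by do !split=> //; try (apply: le_fits; rewrite /M; lia);
  try (apply: M2_lt; rewrite /M; nia); apply: leq_ltn_trans (h2 _) (le_fits _).
Qed.

Lemma below_ok s e1 e2 j i : ready s -> fits B s e1 -> fits B s e2 ->
  value s e1 = j -> value s e2 = i -> j <= n -> i < n ->
  let e := (e1 :==: Var 0) :+: (e2 :<: e1) :*: (edge e2 e1 :==: num 0) in
  fits B s e /\ exists2 b : nat, value s e = b & b <= 2 /\ (b != 0) = below E n j i.
Proof.
move=> rs f1 f2 v1 v2 jn i_n e.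
have fe := edge_ok rs f2 f1 v2 v1 (ltnW i_n) jn.
have [h0 h1 h2 h3] := rs.
have bB (b : bool) : b < B by apply: le_fits; case: b.
rewrite /e !value_bin value_var h0 v1 v2; set a := value s (edge _ _) in fe *; rewrite /=.
split.
  by do !split=> //=; rewrite ?v1 ?v2 ?h0 -/a; try (exact: bB);
    try (apply: le_fits; rewrite /M; lia); apply: M2_lt;
    case: (_ == _); case: (_ < _); case: (_ == _); rewrite /M; lia.
eexists; first by reflexivity.
split; first by case: (_ == _); case: (_ < _); case: (_ == _).
rewrite addn_eq0 muln_eq0 !eqb0 /below; case: (altP (j =P n)) => [//|jNn] /=.
have -> : a = E i j.
  by rewrite /a /edge /= h0 v1 v2 h3 // ltn_neqAle jNn.
by rewrite negb_or !negbK /prec; case: (i < j); case: (E i j).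
Qed.

Lemma fits_mul s e1 e2 a b : fits B s e1 -> fits B s e2 ->
  value s e1 <= a -> value s e2 <= b -> a * b < B -> fits B s (e1 :*: e2).
Proof. by move=> f1 f2 h1 h2; split=> //; apply: leq_ltn_trans (leq_mul h1 h2) _. Qed.

Lemma fits_add s e1 e2 a b : fits B s e1 -> fits B s e2 ->
  value s e1 <= a -> value s e2 <= b -> a + b < B -> fits B s (e1 :+: e2).
Proof. by move=> f1 f2 h1 h2; split=> //; apply: leq_ltn_trans (leq_add h1 h2) _. Qed.

Definition entry (s : state) (b : nat) : seq nat :=
  mkseq (fun p => arr s 3 (b * M + p)) (arr s 2 b).

Definition entries (b : nat) : seq nat := best (b %/ M %/ M) (b %/ M %% M) (b %% M).

(** With cells in linear order, one number describes the progress of three nested loops. *)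
Definition table (b0 : nat) (s : state) := forall b, b < b0 -> entry s b = entries b.

Lemma entries_idx m j k : j <= n -> k <= n -> entries (idx m j k) = best m j k.
Proof.
rewrite /entries /idx => jn kn; have jM : j < M by []; have kM : k < M by [].
by rewrite divnMDl // modnMDl (divn_small kM) (modn_small kM) addn0
  divnMDl // modnMDl (divn_small jM) (modn_small jM) addn0.
Qed.

Lemma idx_mono m j k m' : j <= n -> k <= n -> m < m' -> idx m j k < idx m' 0 0.
Proof. by rewrite /idx /M !addn0 => jn kn; nia. Qed.

Lemma table_same b xs bs s s' : 2 \notin bs -> 3 \notin bs ->
  same xs bs s s' -> table b s -> table b s'.
Proof.
move=> b2 b3 [_ ha] h c cb; rewrite -h // /entry ha //.
by apply: eq_mkseq => p; rewrite ha.
Qed.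

Lemma table_size b0 s m j k : table b0 s -> idx m j k < b0 -> j <= n -> k <= n ->
  arr s 2 (idx m j k) = size (best m j k).
Proof. by move=> h /h; rewrite /entry => h' jn kn; rewrite -entries_idx // -h' size_mkseq. Qed.

Lemma table_nth b0 s m j k p : table b0 s -> idx m j k < b0 -> j <= n -> k <= n ->
  p < size (best m j k) -> arr s 3 (idx m j k * M + p) = nth 0 (best m j k) p.
Proof.
move=> h hb jn kn hp; rewrite -entries_idx // -(h _ hb) /entry nth_mkseq //.
by rewrite (table_size h).
Qed.

(** Products serve as conjunctions and sums as disjunctions of numbers that may exceed 1. The
    factors are at most 2, 2, [1 + n * n] and 1. *)
Lemma guard_ok s j k i x z1 z2 z : ready s ->
  var s 2 = j -> var s 3 = k -> var s 4 = x -> var s 5 = z ->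
  var s 8 = z1 -> var s 9 = z2 -> var s 12 = i ->
  j <= n -> k <= n -> x < n -> i < n -> z1 <= n -> z2 <= n -> z <= n + n + 1 ->
  fits B s guard /\ (value s guard != 0) =
    [&& below E n j i, (x == i) || E x i, (k == i) || (0 < z1) && (0 < z2)
      & z < z1 + z2 + 1].
Proof.
move=> rs v2 v3 v4 v5 v8 v9 v12 jn kn xn i_n z1n z2n zn.
have fv y : var s y <= n + n + 1 -> fits B s (Var y).
  by move=> h; apply: M2_lt; apply: leq_trans h _; rewrite /M; nia.
have {}fv y c : var s y = c -> c <= n + n + 1 -> fits B s (Var y).
  by move=> <-; apply: fv.
have f2 := fv _ _ v2; have f3 := fv _ _ v3; have f4 := fv _ _ v4; have f5 := fv _ _ v5.
have f8 := fv _ _ v8; have f9 := fv _ _ v9; have f12 := fv _ _ v12.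
have {fv} [{}f2 {}f3 {}f4 {}f5] :
    [/\ fits B s (Var 2), fits B s (Var 3), fits B s (Var 4) & fits B s (Var 5)].
  by split; [apply: f2|apply: f3|apply: f4|apply: f5]; lia.
have [{}f8 {}f9 {}f12] : [/\ fits B s (Var 8), fits B s (Var 9) & fits B s (Var 12)].
  by split; [apply: f8|apply: f9|apply: f12]; lia.
have [fb [b eb [lb bb]]] := below_ok rs f2 f12 v2 v12 jn i_n.
have fx := edge_ok rs f4 f12 v4 v12 (ltnW xn) (ltnW i_n).
have vx : value s (edge (Var 4) (Var 12)) = E x i.
  by case: rs => v0 _ _ hE; rewrite -hE // /edge /= v0 v4 v12.
have one_B : 1 < B by apply: le_fits.
have bB (c : bool) : c < B by apply: leq_ltn_trans one_B; case: c.
have z12 : z1 * z2 <= n * n by apply: leq_mul.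
have fc : fits B s ((Var 4 :==: Var 12) :+: edge (Var 4) (Var 12)).
  apply: (@fits_add _ _ _ 1 1) => //; first by split=> //=.
  - by rewrite /=; case: (_ == _).
  - by rewrite vx; case: (E x i).
  - by apply: M2_lt; rewrite /M; lia.
have fk : fits B s ((Var 3 :==: Var 12) :+: Var 8 :*: Var 9).
  apply: (@fits_add _ _ _ 1 (n * n)) => //.
  - by split=> //=.
  - by apply: (@fits_mul _ _ _ n n); rewrite //= ?v8 ?v9 //; apply: M2_lt; rewrite /M; nia.
  - by rewrite /=; case: (_ == _).
  - by rewrite /= v8 v9.
  - by apply: M2_lt; rewrite /M; nia.
have fs : fits B s (Var 8 :+: Var 9 :+: num 1).
  apply: (@fits_add _ _ _ (n + n) 1) => //.
  - by apply: (@fits_add _ _ _ n n); rewrite //= ?v8 ?v9 //; apply: M2_lt; rewrite /M; nia.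
  - by rewrite /= v8 v9 leq_add.
  - by apply: M2_lt; rewrite /M; nia.
have fl : fits B s (Var 5 :<: Var 8 :+: Var 9 :+: num 1).
  by split; [exact: f5|exact: fs|exact: bB].
have v_c : value s ((Var 4 :==: Var 12) :+: edge (Var 4) (Var 12)) = (x == i) + E x i.
  by rewrite value_bin vx /= v4 v12.
have v_k : value s ((Var 3 :==: Var 12) :+: Var 8 :*: Var 9) = (k == i) + z1 * z2.
  by rewrite /= v3 v12 v8 v9.
have v_l : value s (Var 5 :<: Var 8 :+: Var 9 :+: num 1) = (z < z1 + z2 + 1).
  by rewrite /= v5 v8 v9.
have xb : (x == i) + E x i <= 2 by case: (_ == _); case: (E x i).
have kb : (k == i) + z1 * z2 <= 1 + n * n by apply: leq_add => //; case: (_ == _).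
split; last first.
  rewrite /guard 3!(value_bin _ Mul) eb v_c v_k v_l /= !muln_eq0 !negb_or bb.
  by rewrite !addn_eq0 muln_eq0 !eqb0 !negb_and !negbK !negb_or -!lt0n -!andbA.
apply: (@fits_mul _ _ _ (4 * (1 + n * n)) 1) => //.
- apply: (@fits_mul _ _ _ 4 (1 + n * n)) => //.
  + by apply: (@fits_mul _ _ _ 2 2); rewrite ?eb ?v_c //; apply: M2_lt; rewrite /M; lia.
  + by rewrite value_bin eb v_c; apply: (leq_mul lb xb).
  + by rewrite v_k.
  + by apply: M2_lt; rewrite /M; nia.
- by rewrite 2!(value_bin _ Mul) eb v_c v_k; apply: leq_mul => //; apply: (leq_mul lb xb).
- by rewrite v_l; case: (_ < _).
- by apply: M2_lt; rewrite /M; nia.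
Qed.

Lemma run_search s m j k i b0 : ready s -> table b0 s -> idx m.+1 0 0 <= b0 ->
  m < n -> j <= n -> k <= n -> i = n - m.+1 ->
  var s 1 = m -> var s 2 = j -> var s 3 = k -> var s 12 = i ->
  run search s (fun s' => same [:: 4; 5; 6; 8; 9] [::] s s' /\
    var s' 6 = argbest E n (best m) i j k n /\
    var s' 5 = size (join n (best m) i j k (var s' 6))).
Proof.
move=> rs tb lb mn jn kn ei v1 v2 v3 v12; have [v0 _ _ _] := rs.
have i_n : i < n by rewrite ei; lia.
have n_B : n < B by apply: le_fits; apply: leqnSn.
have sz m' j' k' : m' <= n -> size (best m' j' k') < B.
  by move=> h; apply: leq_ltn_trans (best_size _ _ h) n_B.
have vB x : x <= n -> x < B by move=> xn; apply: leq_ltn_trans n_B.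
have hb j' k' : j' <= n -> k' <= n -> idx m j' k' < b0.
  by move=> *; apply: leq_trans lb; apply: idx_mono.
have [f1 e1] : fits B s (cell (Var 1) (Var 2) (Var 3)) /\
    value s (cell (Var 1) (Var 2) (Var 3)) = idx m j k.
  by apply: cell_ok => //=; rewrite ?v1 ?v2 ?v3 ?vB // ltnW.
have a1 := table_size tb (hb _ _ jn kn) jn kn.
apply: run_seq; apply: run_assign.
  by split=> //; rewrite e1 a1 sz // ltnW.
apply: run_seq; apply: run_assign; first by rewrite /= v0.
rewrite value_get e1 a1 value_var [var _ 0]v0.
set s1 := set_var _ 6 _.
pose I x (s' : state) := same [:: 4; 5; 6; 8; 9] [::] s s' /\
  (var s' 6 = argbest E n (best m) i j k x /\
   var s' 5 = size (join n (best m) i j k (var s' 6))).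
apply: (run_for (k := n) (I := I)) => //.
- by apply: vB; apply: leq_ltn_trans i_n.
- split; first by do 3 (apply: same_set_var => //).
  by rewrite /= /join eqxx.
- by move=> x s' xn _ [[hv _] _]; rewrite /= hv // v0.
move=> x s' xn v4 [ss [v6 v5]].
have rs' : ready s' by apply: ready_same ss rs.
have tb' : table b0 s' by apply: table_same ss tb.
have [ss1 ss2] := ss.
have v0' : var s' 0 = n by rewrite ss1.
have [v1' v2' v3' v12'] : [/\ var s' 1 = m, var s' 2 = j, var s' 3 = k & var s' 12 = i].
  by rewrite !ss1.
have xn' := ltnW xn; have mn' := ltnW mn.
have [f2 e2] : fits B s' (cell (Var 1) (Var 2) (Var 4)) /\
    value s' (cell (Var 1) (Var 2) (Var 4)) = idx m j x.
  by apply: cell_ok => //=; rewrite ?v1' ?v2' ?v4 ?vB.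
have a2 := table_size tb' (hb _ _ jn xn') jn xn'; set z1 := size _ in a2.
apply: run_seq; apply: run_assign; first by split=> //; rewrite e2 a2 sz.
rewrite value_get e2 a2; set s2 := set_var _ _ _.
have [f3 e3] : fits B s2 (cell (Var 1) (Var 4) (Var 3)) /\
    value s2 (cell (Var 1) (Var 4) (Var 3)) = idx m x k.
  by apply: cell_ok => //=; rewrite ?v1' ?v3' ?v4 ?vB.
have a3 := table_size tb' (hb _ _ xn' kn) xn' kn; set z2 := size _ in a3.
apply: run_seq; apply: run_assign; first by split=> //; rewrite e3 [arr _ _ _]a3 sz.
rewrite value_get e3 [arr _ _ _]a3; set s3 := set_var _ _ _.
have rs3 : ready s3.
  by apply: (@ready_same [:: 8; 9] [::] s') => //; do 2 apply: same_set_var => //.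
have z1n : z1 <= n by apply: best_size.
have z2n : z2 <= n by apply: best_size.
have z5n : var s' 5 <= n + n + 1.
  rewrite v5 /join; case: eqP => _; first by rewrite -addnA (leq_trans (best_size _ _ mn')) ?leq_addr.
  by rewrite size_cat /= addnS -addn1 leq_add2r leq_add // best_size.
have [fg eg] := guard_ok (s := s3) rs3 v2' v3' v4 erefl erefl erefl v12'
  jn kn xn i_n z1n z2n z5n.
have szx : size (join n (best m) i j k x) = z1 + z2 + 1.
  by rewrite /join ltn_eqF // size_cat /= addn1 addnS.
have guardE : (value s3 guard != 0) = joinable E n (best m) i j k x &&
    (size (join n (best m) i j k (argbest E n (best m) i j k x))
       < size (join n (best m) i j k x)).
  by rewrite eg szx -v6 -v5 /joinable -!andbA.
have ss3 : same [:: 4; 5; 6; 8; 9] [::] s s3 by do 2 apply: same_set_var => //.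
have sB : z1 + z2 + 1 < B by apply: M2_lt; rewrite /M; nia.
apply: run_if => // [gt|gf].
- rewrite guardE in gt.
  apply: run_seq; apply: run_assign.
    split; [split; [exact: vB|exact: vB|]|exact: le_fits|exact: sB].
    by apply: leq_ltn_trans sB; rewrite leq_addr.
  apply: run_assign; first by rewrite /= v4 vB.
  split; first exact: v4.
  split; first by do 3 apply: same_set_var => //.
  by rewrite /= v4 gt szx.
- apply: run_skip; split; first exact: v4.
  split; first by apply: same_set_var.
  have : (value s3 guard != 0) = false by rewrite gf.
  by rewrite guardE /= => ->; split.
Qed.

(** The blocks [a] and [b] that are read precede the block [d] that is written, so no source cell is
    overwritten. The last hypothesis describes [join] cell by cell. *)
Lemma run_copy s r l a b d :
  var s 5 = size r -> var s 8 = l -> var s 9 = a * M -> var s 11 = d * M ->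
  (l < size r -> var s 10 = b * M /\ b < d) ->
  a < d -> d < M * M * M -> l <= n -> size r <= n -> all (gtn n) r -> var s 12 <= n ->
  (forall p, p < size r -> nth 0 r p =
     if p < l then arr s 3 (a * M + p) else
     if p == l then var s 12 else arr s 3 (b * M + (p - l - 1))) ->
  run copy s (fun s' => same [:: 7] [:: 3] s s' /\
    (forall p, p < size r -> arr s' 3 (d * M + p) = nth 0 r p) /\
    (forall q, q < d * M -> arr s' 3 q = arr s 3 q)).
Proof.
move=> v5 v8 v9 v11 h10 ad dM ln rn ar v12 hr.
have n_B : n < B by apply: le_fits; apply: leqnSn.
have lower b' p : b' < d -> p <= n -> b' * M + p < d * M.
  by move=> h1 h2; apply: leq_trans (leq_mul h1 (leqnn M)); rewrite mulSn addnC ltn_add2r.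
have nthB p : p < size r -> nth 0 r p < B.
  by move=> pr; apply: ltn_trans n_B; apply: (allP ar); apply: mem_nth.
pose I x (s' : state) := same [:: 7] [:: 3] s s' /\
  ((forall p, p < x -> arr s' 3 (d * M + p) = nth 0 r p) /\
   (forall q, q < d * M -> arr s' 3 q = arr s 3 q)).
apply: (run_for (k := size r) (I := I)).
- exact: leqW.
- exact: le_fits.
- exact: leq_ltn_trans n_B.
- by split=> //; apply: same_set_var.
- move=> x s' _ _ [[h _] _]; rewrite /= h // v5; split=> //.
  by apply: leq_ltn_trans rn n_B.
- move=> x s' xr v7 [ss [hd hq]]; have [hv _] := ss.
  have xn : x <= n by apply: leq_trans rn; apply: ltnW.
  have xB : x < B by apply: leq_ltn_trans n_B.
  have w5 : var s' 5 = size r by rewrite hv.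
  have w8 : var s' 8 = l by rewrite hv.
  have w9 : var s' 9 = a * M by rewrite hv.
  have w11 : var s' 11 = d * M by rewrite hv.
  have w12 : var s' 12 = var s 12 by rewrite hv.
  have lB : l < B by apply: leq_ltn_trans n_B.
  have bB (c : bool) : c < B by apply: le_fits; case: c.
  have dxB := pos_fits dM xn.
  have dB : d * M < B by apply: leq_ltn_trans dxB; rewrite leq_addr.
  have fd : fits B s' (Var 11 :+: Var 7) by rewrite /= w11 v7.
  have written q0 v : q0 = d * M + x -> v = nth 0 r x ->
      var (set_arr s' 3 q0 v) 7 = x /\ I x.+1 (set_var (set_arr s' 3 q0 v) 7 x.+1).
    move=> -> ev; split=> //; split; first by apply: same_set_var => //; apply: same_set_arr.
    split=> [p px|q qd] /=.
      rewrite eqn_add2l; case: (altP (p =P x)) => [->|pNx] //.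
      by apply: hd; rewrite ltn_neqAle pNx.
    case: (altP (q =P _)) => [e|_]; last exact: hq.
    by move: qd; rewrite e ltnNge leq_addr.
  have ex := hr _ xr; have nB := nthB _ xr.
  apply: run_if => [|vl|vl].
  + by rewrite /= v7 w8.
  + move: vl; rewrite /= v7 w8 eqb0 negbK => xl; rewrite xl in ex.
    have axd := lower _ _ ad xn.
    have axB : a * M + x < B by apply: ltn_trans axd dB.
    apply: run_put => //; last by apply: written; rewrite /= ?w11 v7 // w9 hq.
    rewrite /= w9 v7 hq // -ex; split=> //; split=> //.
    by apply: leq_ltn_trans axB; rewrite leq_addr.
  + move: vl; rewrite /= v7 w8 => /eqP; rewrite eqb0 => /negPf xl; rewrite xl in ex.
    apply: run_if => [|vl|vl].
    * by rewrite /= v7 w8.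
    * move: vl; rewrite /= v7 w8 eqb0 negbK => xl'; rewrite xl' in ex.
      apply: run_put => //; first by rewrite /= w12 (leq_ltn_trans v12).
      by apply: written; rewrite /= ?w11 ?v7 // w12.
    move: vl; rewrite /= v7 w8 => /eqP; rewrite eqb0 => /negPf xl'; rewrite xl' in ex.
    have lx : l < x by rewrite ltn_neqAle eq_sym xl' leqNgt xl.
    have [v10 bd] := h10 (ltn_trans lx xr).
    have w10 : var s' 10 = b * M by rewrite hv.
    have pn : x - l - 1 <= n by rewrite -subnDA (leq_trans (leq_subr _ _)).
    have bxd := lower _ _ bd pn.
    have bxB : b * M + (x - l - 1) < B by apply: ltn_trans bxd dB.
    apply: run_put => //; last by apply: written; rewrite /= ?w11 v7 // w10 w8 hq.
    rewrite /= w10 v7 w8 hq // -ex; split=> //; split=> //.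
      by apply: leq_ltn_trans bxB; rewrite leq_addr.
    split; [split=> //|exact: le_fits|].
      by apply: leq_ltn_trans xB; rewrite leq_subr.
    by apply: leq_ltn_trans bxB; rewrite leq_addl.
- by move=> s' _ [ss [hd hq]].
Qed.

Lemma run_store s m j k i :
  let b0 := idx m.+1 j k in
  let x := argbest E n (best m) i j k n in
  ready s -> table b0 s -> m < n -> j <= n -> k <= n -> i = n - m.+1 ->
  var s 1 = m -> var s 2 = j -> var s 3 = k -> var s 12 = i -> var s 6 = x ->
  var s 5 = size (best m.+1 j k) ->
  run store s (fun s' => same [:: 7; 8; 9; 10; 11] [:: 2; 3] s s' /\ table b0.+1 s').
Proof.
move=> b0 x rs tb mn jn kn ei v1 v2 v3 v12 v6 v5; have [v0 _ _ _] := rs.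
have n_B : n < B by apply: le_fits; apply: leqnSn.
have vB y : y <= n -> y < B by move=> yn; apply: leq_ltn_trans n_B.
have mn' := ltnW mn.
have hb j' k' : j' <= n -> k' <= n -> idx m j' k' < b0.
  move=> j'n k'n; apply: (@leq_trans (idx m.+1 0 0)); first exact: idx_mono.
  by rewrite /b0 /idx leq_add // leq_mul // leq_add.
have b0M : b0 < M * M * M by apply: idx_lt.
have posB b : b < M * M * M -> b * M < B.
  by move=> h; have := pos_fits h (leq0n n); rewrite addn0.
have fM s' : var s' 0 = n -> fits B s' (Var 0 :+: num 1).
  by move=> e; rewrite /= e addn1; split; [apply: vB|apply: le_fits|apply: le_fits].
have cellM s' e1 e2 e3 b : var s' 0 = n -> fits B s' (cell e1 e2 e3) ->
    value s' (cell e1 e2 e3) = b -> b < M * M * M ->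
    fits B s' (cell e1 e2 e3 :*: (Var 0 :+: num 1)) /\
    value s' (cell e1 e2 e3 :*: (Var 0 :+: num 1)) = b * M.
  move=> e0 fc ec hb'.
  have -> : value s' (cell e1 e2 e3 :*: (Var 0 :+: num 1)) = b * M.
    by rewrite value_bin ec /= e0 addn1.
  by split=> //; split; [|exact: fM|rewrite ec /= e0 addn1; apply: posB].
pose r := best m.+1 j k.
have [rx xP] : r = join n (best m) i j k x /\ (x = n \/ x < n).
  split; first by rewrite /r /x ei.
  by case: (argbestP E (best m) i j k (leqnn n)) => [|/andP[]]; [left|right].
have rn : size r <= n by apply: best_size.
apply: run_seq.
apply: (@run_weaken _ _ _ _ (fun s' => same [:: 8; 9; 10] [::] s s' /\
  exists l a b, [/\ var s' 8 = l /\ l <= n, var s' 9 = a * M, a < b0,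
    l < size r -> var s' 10 = b * M /\ b < b0
    & forall p, p < size r -> nth 0 r p =
     if p < l then arr s 3 (a * M + p) else
     if p == l then i else arr s 3 (b * M + (p - l - 1))])).
  apply: run_if.
  - by rewrite /= v6 v0; split=> //; [case: xP => [->|]; auto|apply: le_fits; case: (_ == _)].
  - rewrite /= v6 v0 eqb0 negbK => /eqP xn.
    apply: run_seq; apply: run_assign; first by rewrite /= v5 vB.
    have [f1 e1] : fits B (set_var s 8 (value s (Var 5))) (cell (Var 1) (Var 2) (Var 3)) /\
        value (set_var s 8 (value s (Var 5))) (cell (Var 1) (Var 2) (Var 3)) = idx m j k.
      by apply: cell_ok => //=; rewrite ?v1 ?v2 ?v3 ?vB.
    have [f2 e2] := cellM (set_var s 8 (value s (Var 5))) _ _ _ _ v0 f1 e1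
      (ltn_trans (hb _ _ jn kn) b0M).
    apply: run_assign => //; split; first by do 2 apply: same_set_var => //.
    (* The first part is the whole path, and 0 is a dummy: no second block is read. *)
    exists (size r), (idx m j k), 0; split; rewrite ?ltnn ?e2 //.
    + exact: hb.
    + move=> p pr; rewrite pr rx /join xn eqxx (table_nth tb) //; first exact: hb.
      by move: pr; rewrite rx /join xn eqxx.
  - rewrite /= v6 v0 => /eqP; rewrite eqb0 => xn.
    have {xP} xn' : x < n by case: xP => // e; rewrite e eqxx in xn.
    have x_n := ltnW xn'.
    have [f1 e1] : fits B s (cell (Var 1) (Var 2) (Var 6)) /\
        value s (cell (Var 1) (Var 2) (Var 6)) = idx m j x.
      by apply: cell_ok => //=; rewrite ?v1 ?v2 ?v6 ?vB.
    have a1 := table_size tb (hb _ _ jn x_n) jn x_n.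
    have z1n : size (best m j x) <= n by apply: best_size.
    apply: run_seq; apply: run_assign; first by split=> //; rewrite e1 a1 vB.
    rewrite value_get e1 a1; set s1 := set_var _ _ _.
    have [f2 e2] : fits B s1 (cell (Var 1) (Var 2) (Var 6)) /\
        value s1 (cell (Var 1) (Var 2) (Var 6)) = idx m j x.
      by apply: cell_ok => //=; rewrite ?v1 ?v2 ?v6 ?vB.
    have [f3 e3] := cellM s1 _ _ _ _ v0 f2 e2 (ltn_trans (hb _ _ jn x_n) b0M).
    apply: run_seq; apply: run_assign => //; rewrite e3; set s2 := set_var _ _ _.
    have [f4 e4] : fits B s2 (cell (Var 1) (Var 6) (Var 3)) /\
        value s2 (cell (Var 1) (Var 6) (Var 3)) = idx m x k.
      by apply: cell_ok => //=; rewrite ?v1 ?v3 ?v6 ?vB.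
    have [f5 e5] := cellM s2 _ _ _ _ v0 f4 e4 (ltn_trans (hb _ _ x_n kn) b0M).
    apply: run_assign => //; rewrite e5; split; first by do 3 apply: same_set_var => //.
    exists (size (best m j x)), (idx m j x), (idx m x k); split=> //.
    + exact: hb.
    + by move=> _; split=> //; apply: hb.
    + move=> p; rewrite rx /join (negPf xn) size_cat /= nth_cat => pr.
      case: ltnP => [pl|lp]; first by rewrite (table_nth tb) //; apply: hb.
      case: (altP (p =P _)) => [->|pl]; first by rewrite subnn.
      have pl' : size (best m j x) < p by rewrite ltn_neqAle eq_sym pl.
      have e : p - size (best m j x) = (p - size (best m j x) - 1).+1.
        by rewrite subn1 prednK // subn_gt0.
      rewrite {1}e /= (table_nth tb) //; first exact: hb.
      by move: pr pl'; clear; lia.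
move=> s1 [ss1 [l [a [b [[u8 ln] u9 ab u10 hr]]]]].
have [hv1 ha1] := ss1.
have [w0 w1 w2 w3] : [/\ var s1 0 = n, var s1 1 = m, var s1 2 = j & var s1 3 = k].
  by rewrite !hv1.
have [w5 w12] : var s1 5 = size r /\ var s1 12 = i by rewrite !hv1.
have i_n : i <= n by rewrite ei leq_subr.
have cellS s' : var s' 0 = n -> var s' 1 = m -> var s' 2 = j -> var s' 3 = k ->
    fits B s' (cell (Var 1 :+: num 1) (Var 2) (Var 3)) /\
    value s' (cell (Var 1 :+: num 1) (Var 2) (Var 3)) = b0.
  move=> e0 e1 e2 e3; apply: cell_ok => //=; rewrite ?e1 ?e2 ?e3 ?addn1 //; try exact: vB.
  by split; [exact: vB|exact: le_fits|exact: vB].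
have [f1 e1] := cellS _ w0 w1 w2 w3.
have [f2 e2] := cellM _ _ _ _ _ w0 f1 e1 b0M.
apply: run_seq; apply: run_assign => //; rewrite e2; set s2 := set_var _ _ _.
apply: run_seq.
apply: (run_weaken (run_copy (s := s2) (r := r) (l := l) (a := a) (b := b) (d := b0)
  _ _ _ _ _ _ _ _ _ _ _ _)) => //=.
- exact: best_lt.
- by rewrite w12.
- by move=> p pr; rewrite hr // !ha1 // w12.
move=> s3 [ss3 [hd hq]]; have [hv3 ha3] := ss3.
have [f3 e3] : fits B s3 (cell (Var 1 :+: num 1) (Var 2) (Var 3)) /\
    value s3 (cell (Var 1 :+: num 1) (Var 2) (Var 3)) = b0.
  by apply: cellS; rewrite hv3.
have x5 : var s3 5 = size r by rewrite hv3.
apply: run_put => //; first by rewrite /= x5 vB.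
rewrite e3 value_var x5; split.
  apply: same_set_arr => //.
  apply: (@same_trans _ _ s s1); first by apply: same_sub ss1.
  apply: (@same_trans _ _ s1 s2); first by apply: same_set_var.
  by apply: same_sub ss3.
move=> c; rewrite ltnS leq_eqVlt => /orP[/eqP ->|cb].
  rewrite entries_idx // /entry /= eqxx /=;
  apply: (@eq_from_nth _ 0); rewrite size_mkseq // => p pr.
  by rewrite nth_mkseq // hd.
(* Older paths have at most [n] vertices, so they end before cell [b0 * M]. *)
have sc : arr s 2 c <= n.
  have := congr1 size (tb _ cb); rewrite /entry size_mkseq => ->; apply: best_size.
  have cM : c < M * M * M := ltn_trans cb b0M.
  have : c %/ M %/ M < M by rewrite !ltn_divLR.
  by [].
rewrite -(tb _ cb) /entry /= (ltn_eqF cb) /= ha3 // [arr s2 2 c]ha1 //.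
apply: (@eq_from_nth _ 0); rewrite !size_mkseq // => p pc.
rewrite !nth_mkseq // hq ?ha1 //.
have h : c * M + p < c.+1 * M by rewrite mulSn addnC ltn_add2r ltnS (leq_trans (ltnW pc)).
by apply: leq_trans h _; rewrite leq_mul2r cb orbT.
Qed.

(** The layer for [m = 0] holds only empty paths, which is what zeroed memory represents. The
    invariants of the nested loops fit together because [idx m j M] is [idx m j.+1 0] and
    [idx m M 0] is [idx m.+1 0 0]. *)
Lemma run_fill s : ready s -> table (idx 1 0 0) s ->
  run fill s (fun s' => same (iota 1 12) [:: 2; 3] s s' /\ table (idx n.+1 0 0) s').
Proof.
move=> rs tb; have [v0 _ _ _] := rs.
have n_B : n < B by apply: le_fits; apply: leqnSn.
have one_B : 1 < B by apply: le_fits.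
have M_B : M < B by apply: le_fits.
have bound xs bs s' : 0 \notin xs -> same xs bs s s' ->
    fits B s' (Var 0 :+: num 1) /\ value s' (Var 0 :+: num 1) = M.
  by move=> x0 [h _]; rewrite /= h // v0 addn1; split.
apply: (run_for (k := n) (I := fun m s' => same (iota 1 12) [:: 2; 3] s s' /\
  table (idx m.+1 0 0) s')) => //.
- by split; [apply: same_set_var|apply: (@table_same _ [:: 1] [::] s) => //; apply: same_set_var].
- by move=> m s' _ _ [[h _] _]; rewrite /= h // v0.
move=> m s1 mn v1 [ss1 tb1]; have [h1 _] := ss1.
have rs1 : ready s1 by apply: ready_same ss1 rs.
have w0 : var s1 0 = n by rewrite h1.
apply: run_seq; apply: run_assign.
  rewrite /= w0 v1; split=> //.
    by split; rewrite // ?(ltn_trans mn) // (leq_ltn_trans (leq_subr _ _)).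
  by rewrite -subnDA (leq_ltn_trans (leq_subr _ _)).
have -> : value s1 (Var 0 :-: Var 1 :-: num 1) = n - m.+1 by rewrite /= w0 v1 -subnDA addn1.
set s2 := set_var _ _ _.
have ss2 : same (iota 1 12) [:: 2; 3] s s2 by apply: same_set_var.
have tb2 : table (idx m.+1 0 0) s2 by apply: (@table_same _ [:: 12] [::] s1) => //; apply: same_set_var.
pose keep := same (iota 2 10) [:: 2; 3] s2.
have keepS s' : keep s' -> same (iota 1 12) [:: 2; 3] s s'.
  by move=> h; apply: same_trans ss2 _; apply: same_sub h.
apply: (run_for (k := M) (I := fun j s' => keep s' /\ table (idx m.+1 j 0) s')) => //.
- by split; [apply: same_set_var|apply: (@table_same _ [:: 2] [::] s2) => //; apply: same_set_var].
- by move=> j s' _ _ [/keepS h _]; apply: bound h.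
- move=> j s3 jM v2 [ss3 tb3].
  apply: (run_for (k := M) (I := fun k s' => (keep s' /\ var s' 2 = j) /\ table (idx m.+1 j k) s')) => //.
  + by split; [split => //; apply: same_set_var|apply: (@table_same _ [:: 3] [::] s3) => //; apply: same_set_var].
  + by move=> k s' _ _ [[/keepS h _] _]; apply: bound h.
  + move=> k s4 kM v3 [[ss4 w2] tb4]; have [h4 _] := ss4.
    have rs4 : ready s4 by apply: ready_same (keepS _ ss4) rs.
    have [u1 u12] : var s4 1 = m /\ var s4 12 = n - m.+1 by rewrite !h4.
    apply: run_seq.
    apply: (run_weaken (run_search (s := s4) (m := m) (j := j) (k := k) (i := n - m.+1)
      (b0 := idx m.+1 j k) rs4 tb4 _ mn _ _ _ _ _ _ _)) => //.
      by rewrite /idx leq_add // leq_mul // leq_add.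
    move=> s5 [ss5 [x6 x5]]; have [h5 _] := ss5.
    have rs5 : ready s5 by apply: ready_same ss5 rs4.
    have [y1 y2 y3 y12] : [/\ var s5 1 = m, var s5 2 = j, var s5 3 = k & var s5 12 = n - m.+1].
      by rewrite !h5.
    apply: (run_weaken (run_store (s := s5) (m := m) (j := j) (k := k) (i := n - m.+1)
      rs5 _ mn _ _ _ _ _ _ _ _ _)) => //.
    * exact: table_same ss5 tb4.
    * by rewrite x5 x6.
    move=> s6 [ss6 tb6]; have [h6 _] := ss6.
    split; first by rewrite h6 // h5.
    have ss46 : keep s6.
      apply: (same_trans ss4); apply: (@same_trans _ _ s4 s5).
        by apply: same_sub ss5.
      by apply: same_sub ss6.
    split; first by split; [apply: same_set_var|rewrite /= h6 // h5].
    apply: (@table_same _ [:: 3] [::] s6) => //; first by apply: same_set_var.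
    by rewrite /idx addnS.
  + move=> s4 v3 [[ss4 w2] tb4]; split=> //; split; first by apply: same_set_var.
    apply: (@table_same _ [:: 2] [::] s4) => //; first by apply: same_set_var.
    by rewrite (_ : idx m.+1 j.+1 0 = idx m.+1 j M) // /idx addn0 addnS mulSnr.
- move=> s3 v2 [ss3 tb3]; have [h3 _] := ss3; split; first by rewrite h3.
  split; first by apply: same_set_var => //; apply: keepS.
  apply: (@table_same _ [:: 1] [::] s3) => //; first by apply: same_set_var.
  by rewrite (_ : idx m.+2 0 0 = idx m.+1 M 0) // /idx !addn0 -mulSnr.
Qed.

(** The result may overwrite array 0, as the adjacency matrix is not read any more; array 1 turns
    positions back into vertices. *)
Lemma run_extract s : ready s -> table (idx n.+1 0 0) s ->
  run extract s (fun s' => exists k,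
    (forall k', k' <= n -> size (best n n k') <= size (best n n k)) /\
    output s' = [seq arr s 1 r | r <- best n n k]).
Proof.
move=> rs tb; have [v0 _ _ _] := rs.
have n_B : n < B by apply: le_fits; apply: leqnSn.
have one_B : 1 < B by apply: le_fits.
have M_B : M < B by apply: le_fits.
have vB x : x <= n -> x < B by move=> xn; apply: leq_ltn_trans n_B.
have hb k : k <= n -> idx n n k < idx n.+1 0 0 by move=> kn; apply: idx_mono.
have cellN x y s' : same y [::] s s' -> 0 \notin y -> var s' x <= n ->
    fits B s' (cell (Var 0) (Var 0) (Var x)) /\
    value s' (cell (Var 0) (Var 0) (Var x)) = idx n n (var s' x).
  by move=> [h _] y0 xn; apply: cell_ok => //=; rewrite ?(h 0) ?v0 ?vB.
have lenN x y s' : same y [::] s s' -> 0 \notin y -> var s' x <= n ->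
    fits B s' (Get 2 (cell (Var 0) (Var 0) (Var x))) /\
    value s' (Get 2 (cell (Var 0) (Var 0) (Var x))) = size (best n n (var s' x)).
  move=> ss y0 xn; have [f e] := cellN _ _ _ ss y0 xn; have [_ ha] := ss.
  have a := table_size tb (hb _ xn) (leqnn n) xn.
  by rewrite value_get e ha // a; split=> //; split; rewrite // e ha // a vB // best_size.
apply: run_seq; apply: run_assign; first exact: ltnW.
set s0 := set_var _ _ _.
have [f0 e0] : fits B s0 (Get 2 (cell (Var 0) (Var 0) (Var 6))) /\
    value s0 (Get 2 (cell (Var 0) (Var 0) (Var 6))) = size (best n n 0).
  by apply: (lenN 6 [:: 6]) => //; apply: same_set_var.
apply: run_seq; apply: run_assign => //; rewrite e0.
apply: run_seq.
apply: (run_for (k := M) (I := fun x s' => same [:: 3; 5; 6] [::] s s' /\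
  [/\ var s' 6 <= n, var s' 5 = size (best n n (var s' 6))
    & forall k, k < x -> size (best n n k) <= var s' 5])) => //.
- by split => //; do 3 apply: same_set_var => //.
- by move=> k s' _ _ [[h _] _]; rewrite /= h // v0 addn1; split.
- move=> k s1 kM v3 [ss1 [w6 w5 w]].
  have kn : var s1 3 <= n by rewrite v3 -ltnS.
  have [f e] := lenN 3 _ _ ss1 isT kn; rewrite v3 in e.
  apply: run_if => [|gtk|lek].
  + split=> //; first by rewrite /= vB // w5 best_size.
    by rewrite value_var e /=; case: (_ < size _); [exact: one_B|exact: ltnW one_B].
  + apply: run_seq; apply: run_assign => //; rewrite e.
    have gtk' : var s1 5 < size (best n n k).
      by move: gtk; rewrite value_bin e /= eqb0 negbK.
    apply: run_assign; first by rewrite /= v3 vB // -v3.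
    split=> //; split; first by do 3 apply: same_set_var => //.
    rewrite /= v3; split=> //.
    move=> k'; rewrite ltnS leq_eqVlt => /orP[/eqP -> //|/w h].
    by apply: leq_trans h (ltnW gtk').
  + apply: run_skip; split=> //; split; first by apply: same_set_var.
    have ge' : size (best n n k) <= var s1 5.
      by move: lek; rewrite value_bin e /= => /eqP; rewrite eqb0 -leqNgt.
    by split=> //= k'; rewrite ltnS leq_eqVlt => /orP[/eqP -> //|/w].
move=> s1 _ [ss1 [k1n w5 w]]; set k1 := var s1 6 in k1n w5.
set r := best n n k1 in w5 *; have [h1 ha1] := ss1.
have w0 : var s1 0 = n by rewrite h1.
have rn : size r <= n by apply: best_size.
have [f1 e1] := cellN 6 _ _ ss1 isT k1n.
have idM : idx n n k1 < M * M * M by apply: idx_lt.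
have posB p : p <= n -> idx n n k1 * M + p < B by apply: pos_fits.
have baseB : idx n n k1 * M < B by have := posB _ (leq0n n); rewrite addn0.
apply: run_seq; apply: run_assign.
  split=> //; first by rewrite /= w0 addn1; split=> //; apply: vB.
  by rewrite e1 /= w0 addn1.
have -> : value s1 (cell (Var 0) (Var 0) (Var 6) :*: (Var 0 :+: num 1)) = idx n n k1 * M.
  by rewrite value_bin e1 /= w0 addn1.
set s2 := set_var _ _ _.
apply: run_seq.
apply: (run_for (k := size r) (I := fun x s' => same [:: 7] [:: 0] s2 s' /\
  forall p, p < x -> arr s' 0 p = arr s 1 (nth 0 r p))) => //.
- exact: leqW.
- exact: leq_ltn_trans n_B.
- by split => //; apply: same_set_var.
- by move=> x s' _ _ [[h _] _]; rewrite /= h //= w5 vB.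
- move=> x s3 xr v7 [[h3 ha3] hx].
  have xn : x <= n by apply: leq_trans rn; apply: ltnW.
  have w9 : var s3 9 = idx n n k1 * M by rewrite h3.
  have ra : arr s3 3 (idx n n k1 * M + x) = nth 0 r x.
    by rewrite ha3 // [arr s2 _ _]ha1 // (table_nth tb) //; apply: hb.
  have rx : nth 0 r x < n by apply: (allP (best_lt _ _ (leqnn n))); apply: mem_nth.
  have a1 : arr s3 1 (nth 0 r x) = arr s 1 (nth 0 r x) by rewrite ha3 // [arr s2 _ _]ha1.
  have ab : arr s 1 (nth 0 r x) <= n by case: rs => _ h _ _; apply: h; apply: ltnW.
  apply: run_put; first by rewrite /= v7 vB.
    rewrite /= w9 v7 ra a1; split; last exact: vB.
    by split; [split; [exact: baseB|exact: vB|exact: posB]|exact: ltn_trans rx n_B].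
  split=> //; rewrite /= w9 v7 ra a1; split.
    by apply: same_set_var => //; apply: same_set_arr.
  move=> p px /=; case: (altP (p =P x)) => [->|pNx] //.
  by apply: hx; rewrite ltn_neqAle pNx.
move=> s3 _ [[h3 ha3] hx].
have x5 : var s3 5 = size r by rewrite h3.
apply: run_assign; first by rewrite /= x5 vB.
exists k1; split=> [k' k'n|]; first by rewrite -/r -w5; apply: w.
rewrite /output /= x5; apply: (@eq_from_nth _ 0); rewrite size_mkseq ?size_map // => p pr.
by rewrite nth_mkseq // hx // (nth_map 0).
Qed.

End Fill.

(** * Computing the LDFS ordering on the machine *)

Definition front : expr := (Var 1 :<: Var 3 :==: num 0) :+: edge (Var 1) (Var 3).

Definition pass (e : expr) : com :=
  For 3 (Var 0)
    (If e (Put 4 (Var 2) (Get 1 (Var 3)) ;; 2 ::= Var 2 :+: num 1) Skip).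

(** Each round is one pivot step of [ldfs]. Array 4 collects the positions up to the pivot together
    with its neighbours, then everything else; the processed prefix is thus left in place. *)
Definition reorder : com :=
  For 1 (Var 0)
    (2 ::= num 0 ;;
     pass front ;;
     pass (front :==: num 0) ;;
     For 3 (Var 0) (Put 1 (Var 3) (Get 4 (Var 3)))).

Section Reorder.

Variables (n B : nat) (G : sgraph 'I_n).
Hypothesis HB : 4 * (n.+1 * n.+1) <= B.

Local Notation run := (run B n.+1).

Lemma small_word x : x <= n.+1 -> x < B.
Proof. by move=> h; apply: leq_trans HB; nia. Qed.

Lemma run_pass s e (C : pred nat) r :
  var s 0 = n -> (forall u, u < n -> arr s 1 u < n) ->
  mkseq (arr s 4) (var s 2) = r -> size r + count C (iota 0 n) <= n ->
  (forall s' i, same [:: 2; 3] [:: 4] s s' -> var s' 3 = i -> i < n ->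
     fits B s' e /\ (value s' e != 0) = C i) ->
  run (pass e) s (fun s' => same [:: 2; 3] [:: 4] s s' /\
    mkseq (arr s' 4) (var s' 2) = r ++ [seq arr s 1 i | i <- iota 0 n & C i]).
Proof.
move=> v0 a1 er rn he.
have n_B : n < B by apply: small_word; apply: leqnSn.
have one_B : 1 < B by apply: small_word.
apply: (run_for (k := n) (I := fun x s' => same [:: 2; 3] [:: 4] s s' /\
  mkseq (arr s' 4) (var s' 2) = r ++ [seq arr s 1 i | i <- iota 0 x & C i])) => //.
- by split; [apply: same_set_var|rewrite cats0].
- by move=> x s' _ _ [[h _] _]; rewrite /= h // v0.
move=> x s' xn v3 [ss es]; have [h ha] := ss.
have [fe ee] := he _ _ ss v3 xn.
have v2 : var s' 2 = size r + count C (iota 0 x).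
  by rewrite -(size_mkseq (arr s' 4) (var s' 2)) es size_cat size_map size_filter.
have iS : iota 0 x.+1 = rcons (iota 0 x) x by rewrite -addn1 iotaD cats1.
have cS : count C (iota 0 x.+1) <= count C (iota 0 n).
  by rewrite -(subnKC xn) [iota 0 (_ + _)]iotaD count_cat leq_addr.
apply: run_if => // [gt|ge].
- have Cx : C x by rewrite -ee.
  rewrite iS -cats1 count_cat /= Cx in cS.
  have v2n : var s' 2 < n by rewrite v2; move: rn cS; clear; lia.
  have a1x : arr s' 1 x = arr s 1 x by rewrite ha.
  apply: run_seq; apply: run_put; first by rewrite /= (ltn_trans v2n).
    by rewrite /= v3 a1x; split; apply: ltn_trans n_B => //; apply: a1.
  apply: run_assign.
    rewrite /= addn1; split=> //; first exact: ltn_trans n_B.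
    exact: leq_ltn_trans n_B.
  split=> //; split.
    by do 2 (apply: same_set_var => //); apply: same_set_arr.
  rewrite iS filter_rcons Cx map_rcons -rcons_cat -es /= addn1 mkseqS /= !eqxx v3 a1x.
  congr rcons; apply/eq_in_map => p; rewrite mem_iota /= => pl.
  by rewrite ltn_eqF.
- apply: run_skip; split=> //; split; first by apply: same_set_var.
  have Cx : C x = false by rewrite -ee ge.
  by rewrite iS filter_rcons Cx.
Qed.

(** Connects the two passes, which scan positions, with the filters in [ldfs]. *)
Lemma partition_iota (T : eqType) (e : rel T) x0 pre x l :
  let s := pre ++ x :: l in
  let C i := (i <= size pre) || e x (nth x0 s i) in
  [seq nth x0 s i | i <- iota 0 (size s) & C i] ++
  [seq nth x0 s i | i <- iota 0 (size s) & ~~ C i] =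
  rcons pre x ++ (filter (e x) l ++ filter (predC (e x)) l).
Proof.
move=> s C.
have es : s = rcons pre x ++ l by rewrite cat_rcons.
have szs : size s = (size pre).+1 + size l by rewrite es size_cat size_rcons.
have hC i : i \in iota 0 (size pre).+1 -> C i.
  by rewrite mem_iota ltnS /C => /andP[_ ->].
have h1 : [seq i <- iota 0 (size pre).+1 | C i] = iota 0 (size pre).+1.
  by apply/all_filterP/allP => i /hC.
have h2 : [seq i <- iota 0 (size pre).+1 | ~~ C i] = [::].
  apply/eqP; rewrite -size_eq0 size_filter -leqn0 leqNgt -has_count.
  by apply/hasPn => i /hC ->.
have h3 (D : pred nat) (p : pred T) :
    {in iota (size pre).+1 (size l), forall i, D i = p (nth x0 s i)} ->
    [seq nth x0 s i | i <- iota (size pre).+1 (size l) & D i] = filter p l.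
  move=> Dp; rewrite (eq_in_filter Dp) -filter_map map_nth_iota; last by rewrite szs addKn.
  by rewrite es drop_size_cat ?size_rcons // take_size.
rewrite szs !iotaD !filter_cat h1 // h2 cat0s map_cat add0n -catA; congr (_ ++ _).
  rewrite map_nth_iota0; last by rewrite szs leq_addr.
  by rewrite es take_size_cat ?size_rcons.
congr (_ ++ _); apply: h3 => i; rewrite mem_iota => /andP[hi _] /=;
  by rewrite /C leqNgt hi.
Qed.

(** That array 1 vanishes from [n] on later gives the bound at position [n] in [ready]. *)
Definition holds (s : state) (l : seq 'I_n) : Prop :=
  [/\ var s 0 = n, forall a b : 'I_n, arr s 0 (a * n + b) = G a b,
      forall u, arr s 0 u <= 1, forall u, n <= u -> arr s 1 u = 0
    & mkseq (arr s 1) n = map val l].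

Lemma run_reorder s l : holds s l ->
  run reorder s (fun s' => same [:: 1; 2; 3] [:: 1; 4] s s' /\ holds s' (ldfs G n l)).
Proof.
move=> hs; have [v0 a0 a01 a1n a1] := hs.
have n_B : n < B by apply: small_word; apply: leqnSn.
have one_B : 1 < B by apply: small_word.
have sl : size l = n by rewrite -(size_map val) -a1 size_mkseq.
(* [pre] is final and [r] is still to be processed, with its length as the remaining fuel. *)
pose I t (s' : state) := same [:: 1; 2; 3] [:: 1; 4] s s' /\
  exists pre r, [/\ holds s' (pre ++ r), size pre = t
    & pre ++ ldfs G (size r) r = ldfs G n l].
apply: (run_for (k := n) (I := I)) => //.
- by split; [apply: same_set_var|exists [::], l; rewrite sl].
- by move=> x s' _ _ [[h _] _]; rewrite /= h // v0.
- move=> t s1 tn v1 [ss1 [pre [r [hs1 st er]]]].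
  have [w0 b0 b01 b1n b1] := hs1.
  have sn : size (pre ++ r) = n by rewrite -(size_map val) -b1 size_mkseq.
  case: r => [|x r] in hs1 er b1 sn.
    by move: sn tn; rewrite cats0 st => ->; rewrite ltnn.
  have x0 := x.
  have b1E u : u < n -> arr s1 1 u = nth x0 (pre ++ x :: r) u.
    move=> un; rewrite -(nth_mkseq 0 (arr s1 1) un) b1 (nth_map x0) //.
    by rewrite sn.
  have nx : nth x0 (pre ++ x :: r) t = x by rewrite nth_cat st ltnn subnn.
  pose C i := (i <= t) || G x (nth x0 (pre ++ x :: r) i).
  apply: run_seq; apply: run_assign; first exact: ltnW.
  set s2 := set_var _ _ _.
  have front_ok s' i : same [:: 2; 3] [:: 4] s2 s' -> var s' 3 = i -> i < n ->
      fits B s' front /\ value s' front = (i <= t) + G x (nth x0 (pre ++ x :: r) i).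
    move=> [h ha] v3 i_n.
    have e0 : var s' 0 = n by rewrite h.
    have e1 : var s' 1 = t by rewrite h.
    have c1 u : u < n -> arr s' 1 u = nth x0 (pre ++ x :: r) u.
      by move=> un; rewrite ha // -b1E.
    have ee : arr s' 0 (arr s' 1 t * n + arr s' 1 i) = G x (nth x0 (pre ++ x :: r) i).
      by rewrite !c1 // nx ha // b0.
    have lt_n := ltn_ord.
    have bB (b : bool) : b < B by apply: small_word; case: b.
    rewrite /front /edge /= e0 e1 v3 ee eqb0 -leqNgt; split=> //.
    rewrite !c1 // nx; set y := nth _ _ i.
    have xn := ltn_ord x; have yn := ltn_ord y.
    have h4 : x * n + y < B by apply: leq_trans HB; nia.
    have h3 : x * n < B by apply: leq_ltn_trans h4; rewrite leq_addr.
    do !split=> //; try exact: bB; try (by apply: ltn_trans n_B).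
      exact: ltnW.
    apply: (@leq_ltn_trans (1 + 1)); last by apply: leq_trans HB; clear -tn; nia.
    by apply: leq_add; [case: (i <= t)|case: (G _ _)].
  have a1lt u : u < n -> arr s1 1 u < n by move=> un; rewrite b1E.
  have cn : count C (iota 0 n) + count (predC C) (iota 0 n) = n.
    by rewrite count_predC size_iota.
  apply: run_seq; apply: (run_weaken (run_pass (s := s2) (C := C) (r := [::]) w0 _ _ _ _)) => //.
  + by move: cn => /=; clear; lia.
  + move=> s' i ss v3 i_n; have [f ->] := front_ok _ _ ss v3 i_n; split=> //.
    by rewrite addn_eq0 negb_and !eqb0 !negbK.
  move=> s3 [ss3 e3]; have [h3 ha3] := ss3.
  apply: run_seq.
  apply: (run_weaken (run_pass (s := s3) (C := predC C) (e := front :==: num 0) _ _ e3 _ _)) => //.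
  + by rewrite h3.
  + by move=> u un; rewrite ha3 //; apply: a1lt.
  + by rewrite size_map size_filter cn.
  + move=> s' i ss v3 i_n.
    have [f e] := front_ok _ _ (same_trans ss3 ss) v3 i_n; split.
      by split=> //; [apply: ltnW|apply: small_word; rewrite /=; case: (_ == _)].
    by rewrite value_bin e /= /C; case: (i <= t); case: (G _ _).
  move=> s4 [ss4 e4]; have [h4 ha4] := ss4.
  pose l' := rcons pre x ++ (filter (G x) r ++ filter (predC (G x)) r).
  have e4' : mkseq (arr s4 4) n = map val l'.
    have en : var s4 2 = n.
      rewrite -(size_mkseq (arr s4 4) (var s4 2)) e4 /= size_cat !size_map !size_filter.
      by rewrite cn.
    rewrite -{1}en e4 /l' -(partition_iota G x0) sn st map_cat -!map_comp /=.
    have hm (D : pred nat) : [seq arr s2 1 i | i <- iota 0 n & D i] =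
        [seq val (nth x0 (pre ++ x :: r) i) | i <- iota 0 n & D i].
      apply/eq_in_map => i; rewrite mem_filter mem_iota => /and3P[_ _ i_n].
      exact: b1E.
    rewrite hm; congr (_ ++ _); rewrite -hm; apply/eq_in_map => i _.
    by rewrite ha3.
  have k0 : var s4 0 = n by rewrite h4 // h3.
  have k4 u : u < n -> arr s4 4 u < n.
    move=> un; have := congr1 (nth 0 ^~ u) e4'; rewrite nth_mkseq // => ->.
    rewrite (nth_map x0); first exact: ltn_ord.
    by have := congr1 size e4'; rewrite size_mkseq size_map => <-.
  apply: (run_for (k := n) (I := fun y s' => same [:: 3] [:: 1] s4 s' /\
    forall u, arr s' 1 u = if u < y then arr s4 4 u else arr s4 1 u)) => //.
  + by split=> //; apply: same_set_var.
  + by move=> y s' _ _ [[h _] _]; rewrite /= h // k0.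
  + move=> y s5 yn v3 [ss5 e5]; have [h5 ha5] := ss5.
    apply: run_put; first by rewrite /= v3 (ltn_trans yn).
      by rewrite /= v3 ha5 //; split; apply: ltn_trans n_B => //; apply: k4.
    rewrite /= v3; split=> //; split.
      by apply: same_set_var => //; apply: same_set_arr.
    move=> u; rewrite /= ha5 // ltnS leq_eqVlt.
    by case: eqP => [->|_] //=; apply: e5.
  move=> s5 _ [ss5 e5]; have [h5 ha5] := ss5.
  have eqv y : y \notin [:: 2; 3] -> var s5 y = var s1 y.
    move=> hy; rewrite h5; last by move: hy; rewrite !inE; case/norP.
    by rewrite h4 // h3 //= ; move: hy; rewrite !inE; case/norP => /negPf ->.
  split; first by rewrite eqv.
  have ss15 : same [:: 1; 2; 3] [:: 1; 4] s1 s5.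
    split=> [y hy|a j ha]; first by apply: eqv; move: hy; rewrite !inE => /norP[].
    move: ha; rewrite !inE => /norP[a_1 a_4].
    by rewrite ha5 ?inE // ha4 ?inE // ha3 ?inE.
  split; first by apply: same_set_var => //; apply: same_trans ss1 ss15.
  have pl : perm_eq (filter (G x) r ++ filter (predC (G x)) r) r by apply/permPl/perm_filterC.
  exists (rcons pre x), (filter (G x) r ++ filter (predC (G x)) r); split.
  + have a05 u : arr s5 0 u = arr s1 0 u by have [_ ->] := ss15.
    split=> //=.
    * by rewrite eqv.
    * by move=> a b; rewrite a05.
    * by move=> u; rewrite a05.
    * by move=> u nu; rewrite e5 ltnNge nu /= ha4 // ha3 // b1n.
    * rewrite -[RHS]e4'; apply/eq_in_map => u; rewrite mem_iota => /= un.
      by rewrite e5 un.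
  + by rewrite size_rcons st.
  + by rewrite cat_rcons -er (perm_size pl).
- move=> s1 _ [ss1 [pre [r [hs1 st er]]]]; split=> //.
  have [_ _ _ _ b1] := hs1.
  have : size (pre ++ r) = n by rewrite -(size_map val) -b1 size_mkseq.
  rewrite size_cat st => h.
  have r0 : r = [::] by apply/eqP; rewrite -size_eq0 -(eqn_add2l n) addn0 h.
  by move: hs1 er; rewrite r0 /= => + <-.
Qed.

End Reorder.

(** * Correctness *)

Lemma subseq2_index (T : eqType) (x y : T) s :
  uniq s -> subseq [:: x; y] s -> index x s < index y s.
Proof.
elim: s => // z s IH /= /andP[zs us]; rewrite (eq_sym z x) (eq_sym z y).
have [_|xz] := eqVneq x z.
  by rewrite sub1seq; have [->|//] := eqVneq y z; rewrite (negPf zs).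
have [->|yz h] := eqVneq y z; last exact: IH.
by move=> /mem_subseq/(_ z); rewrite !inE eqxx orbT (negPf zs) => /(_ isT).
Qed.

Lemma subseq_nth (T : eqType) (x0 : T) s (l : seq nat) :
  sorted ltn l -> all (gtn (size s)) l -> subseq [seq nth x0 s i | i <- l] s.
Proof.
move=> sl al; have {2}-> : s = [seq nth x0 s i | i <- iota 0 (size s)].
  by rewrite map_nth_iota0 // take_size.
apply: map_subseq; have -> : l = [seq i <- iota 0 (size s) | i \in l].
  apply: (irr_sorted_eq ltn_trans ltnn sl).
    by apply: sorted_filter; [exact: ltn_trans|exact: iota_ltn_sorted].
  move=> i; rewrite mem_filter mem_iota /=; case il: (i \in l) => //=.
  by apply/esym; apply: (allP al).
exact: filter_subseq.
Qed.

(** * Longest paths in terms of positions *)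

Section LongestPosition.

Variables (E : rel nat) (n : nat).
Hypothesis Esym : symmetric E.
Hypothesis E_lt : forall u v, E u v -> u < n.
Hypothesis precT : transitive (prec E).
Hypothesis four_points : forall a b c, a < b -> b < c -> ~~ E a b -> E a c ->
  exists2 d, a < d < b & E d b && ~~ E d c.

Lemma sorted_bound x y p : sorted E [:: x, y & p] -> all (gtn n) [:: x, y & p].
Proof.
move=> /= /andP[xy yp]; rewrite (E_lt xy) /=; rewrite Esym in xy; rewrite (E_lt xy) /=.
elim: p y yp {xy} => //= z p IH y /andP[yz zp].
by rewrite Esym in yz; rewrite (E_lt yz) (IH z).
Qed.

(** As long as some rearrangement of [p] can take another vertex, pass to the longer path; there are
    at most [n] vertices. A path where this stops has a greedy arrangement. *)
Lemma best_longest p : sorted E p -> uniq p -> all (gtn n) p ->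
  exists2 k, k <= n & size p <= size (best E n n n k).
Proof.
have [m] := ubnP (n - size p); elim: m p => // m IH p.
case: p => [|x p] pm sp up bp; first by exists 0.
pose ext d := (d \notin x :: p) && has (fun r => sorted E r) (permutations (d :: x :: p)).
(* The additional vertex is an arbitrary number at first. A path with two or more vertices stays
   below [n] because edges do, which is why the empty path was treated apart. *)
have ext_bound d r : perm_eq r (d :: x :: p) -> sorted E r -> all (gtn n) r.
  move=> /perm_size /=; case: r => [|y [|z r]] // _ sr; exact: sorted_bound.
case: (boolP (has ext (iota 0 n))) => [/hasP[d _ /andP[dp /hasP[r]]]|noext].
  rewrite mem_permutations => rp sr; have br := ext_bound _ _ rp sr.
  have szr : size r = (size p).+2 by rewrite (perm_size rp).
  have ur : uniq r by rewrite (perm_uniq rp) cons_uniq dp.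
  have le_n : size r <= n.
    rewrite -(size_iota 0 n); apply: uniq_leq_size => // v /(allP br).
    by rewrite mem_iota.
  have [|k kn hk] := IH r _ sr ur br.
    by move: pm le_n; rewrite szr /=; clear; lia.
  by exists k => //; apply: leq_trans hk; rewrite szr /= leqW.
have [|||q qp gq] := @greedy_reorder E Esym precT four_points predT [::] (x :: p) _ _ sp isT up.
- by [].
- by [].
- move=> d r; rewrite cat0s => dp rp sr; case/negP: noext.
  apply/hasP; exists d.
    rewrite mem_iota; apply: (allP (ext_bound _ _ rp sr)).
    by rewrite (perm_mem rp) inE eqxx.
  by rewrite /ext dp; apply/hasP; exists r; rewrite ?mem_permutations.
exists (last n q).
  have := mem_last n q; rewrite inE => /orP[/eqP -> //|]; rewrite (perm_mem qp).
  by move/(allP bp)/ltnW.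
rewrite -(perm_size qp); apply: best_complete => //.
- by move=> v; rewrite (perm_mem qp) subnn => /(allP bp).
- by apply/allP => v _; rewrite /below eqxx.
- by rewrite (perm_uniq qp).
Qed.

End LongestPosition.

(** * Translation between vertices and positions *)

Section Positions.

Variables (n : nat) (G : sgraph 'I_n) (pi : seq 'I_n).
Hypothesis pi_ord : vertex_ordering pi.
Hypothesis pi_free : umbrella_free G pi.

Let sigma := ldfs G n pi.

Lemma size_pi : size pi = n.
Proof.
case: pi_ord => up ap; rewrite -(card_uniqP up) -[RHS]card_ord.
by apply: eq_card => x; rewrite !inE ap.
Qed.

Lemma perm_sigma : perm_eq sigma pi.
Proof. by apply: perm_ldfs; rewrite size_pi. Qed.

Lemma uniq_sigma : uniq sigma.
Proof. by rewrite (perm_uniq perm_sigma); case: pi_ord. Qed.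

Lemma mem_sigma x : x \in sigma.
Proof. by rewrite (perm_mem perm_sigma); case: pi_ord. Qed.

Lemma size_sigma : size sigma = n.
Proof. by rewrite (perm_size perm_sigma) size_pi. Qed.

Lemma index_sigma x : index x sigma < n.
Proof. by rewrite -[X in _ < X]size_sigma index_mem mem_sigma. Qed.

Definition before (x y : 'I_n) := (index x pi < index y pi) && ~~ G x y.

(** This is the contrapositive of umbrella-freeness. *)
Lemma before_trans : transitive before.
Proof.
move=> y x z /andP[xy gxy] /andP[yz gyz]; rewrite /before (ltn_trans xy) //=.
apply/negP => /(pi_free xy yz) []; apply/negP => //.
Qed.

Lemma before_total x y : x != y -> ~~ G x y -> before x y || before y x.
Proof.
move=> xy gxy; rewrite /before (adj_sym G y x) gxy !andbT -neq_ltn.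
case: pi_ord => up ap.
by apply: contra xy => /eqP e; rewrite -(nth_index x (ap x)) e nth_index.
Qed.

Lemma sigma_linext : pairwise (fun x y => ~~ before y x) sigma.
Proof.
have [up ap] := pi_ord.
apply: (@ldfs_linext _ _ before) => //.
- exact: before_trans.
- exact: adj_sym.
- by move=> x y /andP[].
- exact: before_total.
- by rewrite size_pi.
case e: (pi) => [|x0 l] //; rewrite -e.
apply/(pairwiseP x0) => i j; rewrite !inE => il jl ij.
by rewrite /before !index_uniq // ltnNge (ltnW ij).
Qed.

(** With [onth], positions from [n] on are isolated and no default vertex is needed, so that [n = 0]
    is covered. *)
Definition pos_adj (u v : nat) : bool :=
  if (onth sigma u, onth sigma v) is (Some x, Some y) then G x y else false.

Lemma pos_adj_sym : symmetric pos_adj.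
Proof.
by move=> u v; rewrite /pos_adj; case: onth => [x|]; case: onth => // y; apply: adj_sym.
Qed.

Lemma pos_adj_nth x0 u v : u < n -> v < n ->
  pos_adj u v = G (nth x0 sigma u) (nth x0 sigma v).
Proof.
have onthn w : w < n -> onth sigma w = Some (nth x0 sigma w).
  move=> wn; have : onth sigma w by rewrite onthTE size_sigma.
  by case e: onth => [x|] // _; rewrite (onth_nth x0 _ _ _ e).
by move=> un vn; rewrite /pos_adj !onthn.
Qed.

Lemma pos_adj_lt u v : pos_adj u v -> u < n.
Proof.
rewrite -[X in _ < X]size_sigma -onthTE /pos_adj; by case: (onth sigma u).
Qed.

Lemma pos_adj_lt2 u v : pos_adj u v -> v < n.
Proof. by rewrite pos_adj_sym; apply: pos_adj_lt. Qed.

(** Since [sigma] is a linear extension of [before], two non-adjacent vertices have the same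
    relative order in [sigma] and in [pi]. *)
Lemma nadj_before x0 u v : u < v -> v < n ->
  ~~ pos_adj u v = before (nth x0 sigma u) (nth x0 sigma v).
Proof.
move=> uv vn; have un := ltn_trans uv vn; rewrite (pos_adj_nth x0) //.
apply/idP/idP => [g|/andP[]//].
have uNv : nth x0 sigma u != nth x0 sigma v.
  by rewrite nth_uniq ?uniq_sigma ?size_sigma // neq_ltn uv.
have := before_total uNv g.
have /(pairwiseP x0)/(_ u v) := sigma_linext.
by rewrite !inE size_sigma => /(_ un vn uv) /negPf ->; rewrite orbF.
Qed.

Lemma pos_prec_trans : transitive (prec pos_adj).
Proof.
move=> v u w /andP[uv guv] /andP[vw gvw]; rewrite /prec (ltn_trans uv vw) /=.
apply/negP => guw; have wn := pos_adj_lt2 guw; have vn := ltn_trans vw wn.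
have x0 : 'I_n := Ordinal wn.
move: guv gvw; rewrite !(nadj_before x0) // => h1 h2.
by have := before_trans h1 h2; rewrite -nadj_before ?guw // (ltn_trans uv).
Qed.

Lemma pos_four_points a b c : a < b -> b < c -> ~~ pos_adj a b -> pos_adj a c ->
  exists2 d, a < d < b & pos_adj d b && ~~ pos_adj d c.
Proof.
move=> ab bc gab gac; have cn := pos_adj_lt2 gac.
have bn := ltn_trans bc cn; have an := ltn_trans ab bn.
have x0 : 'I_n := Ordinal cn.
rewrite !(pos_adj_nth x0) // in gab gac.
have [up _] := pi_ord.
have [||d hd] := @ldfs_four_points _ G n pi (nth x0 sigma a) (nth x0 sigma b)
  (nth x0 sigma c) _ up _ gab gac.
- by rewrite size_pi.
- apply: (@subseq_nth _ x0 sigma [:: a; b; c]); first by rewrite /= ab bc.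
  by rewrite /= size_sigma an bn cn.
have dn := index_sigma d.
have ed : nth x0 sigma (index d sigma) = d by rewrite nth_index // mem_sigma.
move=> hg; exists (index d sigma); last by rewrite !(pos_adj_nth x0) // ed.
have := subseq2_index uniq_sigma (subseq_trans (prefix_subseq [:: nth x0 sigma a; d] _) hd).
have := subseq2_index uniq_sigma (subseq_trans (subseq_cons _ (nth x0 sigma a)) hd).
by rewrite !index_uniq ?uniq_sigma ?size_sigma // => -> ->.
Qed.

Local Notation best := (best pos_adj n).

Lemma all_best_ltn m j k : m <= n -> all (gtn n) (best m j k).
Proof.
move=> mn; apply/allP => v; have [-> //|h] := eqVneq (best m j k) [::].
have [hr _ _ _ _ _] := best_valid pos_adj_sym pos_prec_trans mn h.
by move/hr => /andP[].
Qed.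

Lemma best_longest_path k x0 :
  (forall k', k' <= n -> size (best n n k') <= size (best n n k)) ->
  longest_path G [seq nth x0 sigma u | u <- best n n k].
Proof.
move=> hk; split; [split|].
- rewrite map_inj_in_uniq.
    have [-> //|h] := eqVneq (best n n k) [::].
    by case: (best_valid pos_adj_sym pos_prec_trans (leqnn n) h).
  move=> u v /(allP (all_best_ltn n k (leqnn n))) /= un /(allP (all_best_ltn n k (leqnn n))) /= vn.
  by move/eqP; rewrite nth_uniq ?uniq_sigma ?size_sigma // => /eqP.
- have [-> //|h] := eqVneq (best n n k) [::].
  have [_ _ _ hs _ _] := best_valid pos_adj_sym pos_prec_trans (leqnn n) h.
  rewrite sorted_map; apply: sub_in_sorted hs; last exact: all_best_ltn (leqnn n).
  by move=> u v /= un vn; rewrite -pos_adj_nth.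
- move=> q [uq sq]; rewrite size_map.
  have [|||k' k'n] := @best_longest pos_adj n pos_adj_sym pos_adj_lt pos_prec_trans
    pos_four_points [seq index x sigma | x <- q].
  + rewrite sorted_map; apply: sub_sorted sq => x y /=.
    by rewrite (pos_adj_nth x0) ?index_sigma // !nth_index ?mem_sigma.
  + rewrite map_inj_uniq // => x y /(congr1 (nth x0 sigma)).
    by rewrite !nth_index ?mem_sigma.
  + by apply/allP => _ /mapP[x _ ->]; apply: index_sigma.
  by rewrite size_map => h; apply: leq_trans h (hk _ k'n).
Qed.

End Positions.

Definition longest_path_program : com := reorder ;; fill ;; extract.

(* The word bound (n + 2) ^ k amounts to words of O(log n) bits. *)
Theorem theorem3 :
  exists (P : com) (k : nat) (T : nat -> nat),
    bigO T (fun n => n ^ 4) /\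
    forall (n : nat) (G : sgraph 'I_n) (pi : seq 'I_n),
      cocomparability G -> vertex_ordering pi -> umbrella_free G pi ->
      exists (t : nat) (s : state),
        [/\ exec ((n + 2) ^ k) P (input G pi) t s,
            t <= T n
          & exists p : seq 'I_n, longest_path G p /\ output s = map val p].
Proof.
exists longest_path_program, 8, (fun n => ctime n.+1 longest_path_program); split.
  (* At most four loops are nested: those over [m], [j], [k], and a search or copy inside. The
     factor [2 ^ 4] comes from [n + 1 <= 2 * n]. *)
  exists (ctime 1 longest_path_program * 2 ^ 4), 1 => n n1.
  apply: leq_trans (ctime_poly (d := 4) _ _) _ => //.
  rewrite -mulnA -expnMn leq_mul2l leq_exp2r // mul2n -addnn.
  by apply/orP; right; lia.
move=> n G pi _ pi_ord pi_free; set B := (n + 2) ^ 8.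
pose M := n.+1.
(* Half of the exponent 8 bounds the fourth power of [M], the other half provides the factor
   [16 = 2 ^ 4]. *)
have HB : 16 * (M * M * M * M) <= B.
  rewrite /B (_ : 8 = 4 + 4) // expnD; apply: leq_mul.
    by rewrite -[16]/(2 ^ 4) leq_exp2r // leq_addl.
  by rewrite (_ : M * M * M * M = M ^ 4) ?leq_exp2r // ?/M ?addn2 // !expnS muln1 !mulnA.
have HB2 : 4 * (M * M) <= B by apply: leq_trans HB; rewrite /M; nia.
pose E := pos_adj G pi.
have Es := pos_adj_sym G pi.
have Et := pos_prec_trans pi_ord pi_free.
have sz m j k : m <= n -> size (best E n m j k) <= n by move=> mn; apply: size_best.
have bl m j k : m <= n -> all (gtn n) (best E n m j k) by move=> mn; apply: all_best_ltn.
have size_pi := size_pi pi_ord.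
have hs : holds G (input G pi) pi.
  split=> //= [a b|u|u nu|].
  - congr nat_of_bool; apply/existsP/idP => [[u /existsP[v /andP[/eqP e g]]]|g]; last first.
      by exists a; apply/existsP; exists b; rewrite eqxx.
    have n0 : 0 < n by apply: leq_ltn_trans (ltn_ord a).
    have -> : a = u.
      apply: val_inj; have := congr1 (divn ^~ n) e.
      by rewrite /= !divnMDl // !divn_small ?ltn_ord // !addn0.
    have -> // : b = v.
    apply: val_inj; have := congr1 (modn ^~ n) e.
    by rewrite /= !modnMDl !modn_small ?ltn_ord.
  - by case: [exists x, _].
  - by rewrite nth_default // size_map size_pi.
  - by rewrite -[X in mkseq _ X]size_pi -(size_map val) mkseq_nth.
suff [t [s [ex tT [p hp]]]] : run B M longest_path_program (input G pi) (fun s =>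
    exists p : seq 'I_n, longest_path G p /\ output s = map val p).
  by exists t, s; split=> //; exists p.
apply: run_seq; apply: (run_weaken (run_reorder HB2 hs)) => s1 [ss1 hs1].
have [h1 ha1] := ss1; have [v0 a0 a01 a1n a1] := hs1.
have szs := size_sigma G pi_ord.
have a1E x0 u : u < n -> arr s1 1 u = nth x0 (ldfs G n pi) u.
  move=> un; have := congr1 (nth 0 ^~ u) a1; rewrite nth_mkseq // => ->.
  by rewrite (nth_map x0) // szs.
have rs1 : ready E n s1.
  split=> //.
    move=> u; rewrite leq_eqVlt => /orP[/eqP ->|un]; first by rewrite a1n.
    by rewrite (a1E (Ordinal un)) // ltnW.
  move=> u v un vn; have x0 : 'I_n := Ordinal un.
  by rewrite !(a1E x0) // a0 /E (pos_adj_nth _ pi_ord x0).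
have tb1 : table E n (idx n 1 0 0) s1.
  move=> b hb; rewrite /entry ha1 // /entries -divnMA divn_small //.
  by move: hb; rewrite /idx mul1n !addn0.
apply: run_seq; apply: (run_weaken (run_fill HB sz bl rs1 tb1)) => s2 [ss2 tb2].
have rs2 : ready E n s2 by apply: ready_same ss2 rs1.
apply: (run_weaken (run_extract HB sz bl rs2 tb2)) => s3 [k [hk ek]].
have [_ ha2] := ss2; have br := bl n n k (leqnn n).
case: (pickP (fun _ : 'I_n => true)) => [x0 _|none].
  exists [seq nth x0 (ldfs G n pi) u | u <- best E n n n k]; split.
    exact: best_longest_path.
  rewrite ek -map_comp; apply/eq_in_map => u /(allP br) /= un.
  by rewrite ha2 // (a1E x0).
exists [::]; split; last first.
  rewrite ek; case: (best E n n n k) br => // v l /= /andP[vn _].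
  by have := none (Ordinal vn).
by split=> // -[|x q] //; have := none x.
Qed.
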